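(* Let $G\subset\mathbb C$ be an additive subgroup, free of rank $n\ge1$ with $\mathbb Z$-basis $\epsilon_1=1,\epsilon_2,\dots,\epsilon_n$, with $\frac1k\notin G$ for every integer $k>1$, and let $\lambda\in\mathbb C$, $\lambda\neq-1$. Let $\mathfrak g=\mathfrak g(G,\lambda)$ with universal central extension $\overline{\mathfrak g}$. Let $\xi\in\mathbb C^\times$ with $\xi G=G$, $\chi:G\to\mathbb C^\times$ a character, $f\in\mathrm{Hom}(G,\mathbb C)$, $l\in\mathbb C^\times$, $l_0,l_1,l_3\in\mathbb C$, and let $\theta$ be the automorphism of $\mathfrak g$ given by $$\theta(L_a)=\xi^{-1}\chi(a)L_{\xi a}+\chi(a)\big(l_0\delta_{\lambda,0}+l_1a+l_3a^3\delta_{\lambda,-2}+f(a)\delta_{\lambda,1}\big)I_{\xi a},\qquad\theta(I_a)=l\chi(a)I_{\xi a}.$$ Then the unique automorphism $\overline\theta$ of $\overline{\mathfrak g}$ extending (i.e. inducing) $\theta$ satisfies, for all $a\in G$, \begin{align*} \overline\theta(L_a)={}&\xi^{-1}\chi(a)L_{\xi a}+\chi(a)\big(l_0\delta_{\lambda,0}+l_1a+l_3a^3\delta_{\lambda,-2}+f(a)\delta_{\lambda,1}\big)I_{\xi a}\\ &+\delta_{a,0}\Big(\tfrac{\xi^{-1}-\xi}{24}C_L+(l_1\xi-l_0)C_{LI}^{(0)}\delta_{\lambda,0}+\tfrac12\xi(l_1^2-l_0^2)C_I\delta_{\lambda,0}\Big),\\ \overline\theta(I_a)={}&l\chi(a)I_{\xi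 a}+l\xi\,\delta_{a,0}\Big(\tfrac{\xi^{-1}-\xi}{24}C_{LI}^{(1)}\delta_{\lambda,1}+\big((1-\xi^{-1})C_{LI}^{(0)}+(l_1-l_0)C_I\big)\delta_{\lambda,0}\Big)\\ &+l(\xi\epsilon_1)^{-1}\delta_{a,0}\sum_{i=2}^n(\xi\epsilon_1)_i\,C_{LI}^{(i)}\,\delta_{\lambda,-2},\\ \overline\theta(C_L)={}&\xi C_L-12\,l_1\xi\big(2C_{LI}^{(0)}+l_1C_I\big)\delta_{\lambda,0}, \end{align*} and moreover: - if $\lambda=0$: $\overline\theta(C_{LI}^{(0)})=l\xi\big(C_{LI}^{(0)}+l_1C_I\big)$ and $\overline\theta(C_I)=l^2\xi\,C_I$; - if $\lambda=1$: $\overline\theta(C_{LI}^{(1)})=l\xi^2C_{LI}^{(1)}$; - if $\lambda=-2$: for $2\le i\le n$, $\ \overline\theta(C_{LI}^{(i)})=l(\xi\epsilon_1)^{-1}\sum_{j=2}^n\big(\epsilon_1(\xi\epsilon_i)_j-\epsilon_i(\xi\epsilon_1)_j\big)C_{LI}^{(j)}$.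
   Context: $\mathfrak g(G,\lambda)$ is the complex Lie algebra with basis $\{L_a,I_a\mid a\in G\}$ and brackets $[L_a,L_b]=(b-a)L_{a+b}$, $[L_a,I_b]=(b-\lambda a)I_{a+b}$, $[I_a,I_b]=0$. For $a\in G$, $a_i\in\mathbb Z$ denotes its coefficients in the basis: $a=\sum_{i=1}^na_i\epsilon_i$. $\mathrm{Hom}(G,\mathbb C)$ is the set of additive homomorphisms $G\to\mathbb C$; $\delta$ is the Kronecker delta. For $\lambda\ne-1$ the universal central extension $\overline{\mathfrak g}$ of $\mathfrak g(G,\lambda)$ has basis $L_a,I_a$ ($a\in G$) together with the central elements $C_L$ (always), $C_I,C_{LI}^{(0)}$ (only if $\lambda=0$), $C_{LI}^{(1)}$ (only if $\lambda=1$), $C_{LI}^{(i)}$, $2\le i\le n$ (only if $\lambda=-2$), with brackets $$[L_a,L_b]=(b-a)L_{a+b}+\tfrac1{12}(a^3-a)C_L\delta_{a+b,0},\qquad[I_a,I_b]=aC_I\delta_{a+b,0}\delta_{\lambda,0},$$ $$[L_a,I_b]=(b-\lambda a)I_{a+b}+\delta_{a+b,0}\Big(C_{LI}^{(0)}(a^2+a)\delta_{\lambda,0}+\tfrac1{12}(a^3-a)C_{LI}^{(1)}\delta_{\lambda,1}+\sum_{i=2}^na_iC_{LI}^{(i)}\delta_{\lambda,-2}\Big);$$ the covering map $\overline{\mathfrak g}\to\mathfrak g$ sends $L_a\mapsto L_a$, $I_a\mapsto I_a$ and the central elements listed to $0$. Terms multiplied by a vanishing Kronecker delta are omitted. ''Extending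 $\theta$'' means that $\overline\theta$ is compatible with $\theta$ under the covering map. *)

(* Defs.v *)
From HB Require Import structures.
From mathcomp Require Import all_boot all_order all_algebra.
From mathcomp Require Import reals complex finmap monalg ring.

Set Implicit Arguments.
Unset Strict Implicit.
Unset Printing Implicit Defensive.

Import GRing.Theory Num.Theory.
Local Open Scope ring_scope.

HB.mixin Record Lmodule_isLie (K : fieldType) V of GRing.Lmodule K V := {
  lie : V -> V -> V;
  lie_linearl : forall y, linear (lie^~ y);
  lie_linearr : forall x, linear (lie x);
  liexx : forall x, lie x x = 0;
  lie_jacobi : forall x y z,
    lie x (lie y z) + lie y (lie z x) + lie z (lie x y) = 0 }.

#[short(type="lieAlgType")]
HB.structure Definition LieAlgebra (K : fieldType) :=
  { V of GRing.Lmodule K V & Lmodule_isLie K V }.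

Lemma lieC (K : fieldType) (V : lieAlgType K) (x y : V) : lie x y = - lie y x.
Proof.
have lD u v w : lie (u + v) w = lie u w + lie v w :> V.
  by have := lie_linearl w 1 u v; rewrite !scale1r.
have rD u v w : lie w (u + v) = lie w u + lie w v :> V.
  by have := lie_linearr w 1 u v; rewrite !scale1r.
have := liexx (x + y); rewrite lD !rD !liexx add0r addr0 => /eqP.
by rewrite addr_eq0 => /eqP.
Qed.

Definition lie_hom (K : fieldType) (V W : lieAlgType K) (t : V -> W) : Prop :=
  linear t /\ {morph t : x y / lie x y >-> lie x y}.

Definition lie_aut (K : fieldType) (V : lieAlgType K) (t : V -> V) : Prop :=
  lie_hom t /\ bijective t.

(** [{malg K[T]}] is the vector space with basis [<< k >>], [k : T]. *)

Section FreeModule.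
Context (K : fieldType) (T : choiceType).

Definition lin_ext (V : lmodType K) (f : T -> V) (u : {malg K[T]}) : V :=
  \sum_(k <- msupp u) u@_k *: f k.

Definition bilin_ext (V : lmodType K) (f : T -> T -> V)
    (u v : {malg K[T]}) : V :=
  lin_ext (fun k => lin_ext (f k) v) u.

Lemma lin_extw (V : lmodType K) (f : T -> V) u (d : {fset T}) :
  (msupp u `<=` d)%fset -> lin_ext f u = \sum_(k <- d) u@_k *: f k.
Proof.
move=> sud; rewrite /lin_ext (big_fset_incl _ sud) //= => k _ /mcoeff_outdom ->.
by rewrite scale0r.
Qed.

Lemma lin_ext_linear (V : lmodType K) (f : T -> V) : linear (lin_ext f).
Proof.
move=> a u v; pose d := (msupp u `|` msupp v `|` msupp (a *: u + v))%fset.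
rewrite !(@lin_extw _ f _ d) ?fsubsetUr //; first last.
- by apply: fsubset_trans (fsubsetUl _ _); apply: fsubsetUl.
- by apply: fsubset_trans (fsubsetUl _ _); apply: fsubsetUr.
rewrite scaler_sumr -big_split /=; apply: eq_bigr => k _.
by rewrite mcoeffD mcoeffZ scalerDl scalerA.
Qed.

Lemma lin_extU (V : lmodType K) (f : T -> V) k : lin_ext f << k >> = f k.
Proof.
rewrite (@lin_extw _ f _ [fset k]%fset) ?msuppU_le //.
by rewrite big_seq_fset1 mcoeffUU scale1r.
Qed.

Lemma malg_ind (P : {malg K[T]} -> Prop) :
  P 0 -> (forall a k u, P u -> P (a *: << k >> + u)) -> forall u, P u.
Proof.
move=> P0 PD u; rewrite (monalgE u).
elim: (X in \sum_(_ <- X) _) => [|k s IHs]; first by rewrite big_nil.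
rewrite big_cons; have -> : << u@_k *g k >> = u@_k *: << k >>.
  by apply/malgP => j; rewrite mcoeffZ !mcoeffU mulr_natr.
exact: PD.
Qed.

Lemma eq_linear_malg (V : lmodType K) (f g : {malg K[T]} -> V) :
  linear f -> linear g -> (forall k, f << k >> = g << k >>) -> f =1 g.
Proof.
move=> lf lg fg u.
have l0 h : linear h -> h 0 = 0 :> V.
  by move=> lh; have := lh (-1) 0 0; rewrite scaler0 addr0 scaleN1r addNr.
elim/malg_ind: u => [|a k u IHu]; first by rewrite !l0.
by rewrite lf lg fg IHu.
Qed.

Lemma bilin_extU (V : lmodType K) (f : T -> T -> V) j k :
  bilin_ext f << j >> << k >> = f j k.
Proof. by rewrite /bilin_ext !lin_extU. Qed.

Lemma bilin_ext_linearl (V : lmodType K) (f : T -> T -> V) v :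
  linear (bilin_ext f ^~ v).
Proof. exact: lin_ext_linear. Qed.

Lemma bilin_ext_linearr (V : lmodType K) (f : T -> T -> V) u :
  linear (bilin_ext f u).
Proof.
move=> a v w; rewrite /bilin_ext /lin_ext scaler_sumr -big_split /=.
apply: eq_bigr => k _; rewrite -!/(lin_ext _ _) lin_ext_linear scalerDr.
by rewrite !scalerA mulrC.
Qed.

Section BilinTheory.
Context (V : lmodType K) (f : T -> T -> V).

Lemma bilin_ext0l v : bilin_ext f 0 v = 0.
Proof.
have := bilin_ext_linearl f v (-1) 0 0.
by rewrite scaler0 addr0 scaleN1r addNr.
Qed.

Lemma bilin_ext0r u : bilin_ext f u 0 = 0.
Proof.
have := bilin_ext_linearr f u (-1) 0 0.
by rewrite scaler0 addr0 scaleN1r addNr.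
Qed.

Lemma bilin_extZl a u v : bilin_ext f (a *: u) v = a *: bilin_ext f u v.
Proof.
by have := bilin_ext_linearl f v a u 0; rewrite bilin_ext0l !addr0.
Qed.

Lemma bilin_extZr a u v : bilin_ext f u (a *: v) = a *: bilin_ext f u v.
Proof.
by have := bilin_ext_linearr f u a v 0; rewrite bilin_ext0r !addr0.
Qed.

Lemma bilin_extDl u v w :
  bilin_ext f (u + v) w = bilin_ext f u w + bilin_ext f v w.
Proof. by have := bilin_ext_linearl f w 1 u v; rewrite !scale1r. Qed.

Lemma bilin_extDr u v w :
  bilin_ext f w (u + v) = bilin_ext f w u + bilin_ext f w v.
Proof. by have := bilin_ext_linearr f w 1 u v; rewrite !scale1r. Qed.

Lemma bilin_extNr u v : bilin_ext f u (- v) = - bilin_ext f u v.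
Proof. by rewrite -[- v]scaleN1r bilin_extZr scaleN1r. Qed.

End BilinTheory.

End FreeModule.

Section Bracket.
Context (K : fieldType) (V : lmodType K) (T : Type) (e : T -> V).
Hypothesis span_ind : forall P : V -> Prop,
  P 0 -> (forall a k u, P u -> P (a *: e k + u)) -> forall u, P u.
Variable br : V -> V -> V.
Hypothesis brl : forall v, linear (br^~ v).
Hypothesis brr : forall u, linear (br u).
Hypothesis ekk : forall k, br (e k) (e k) = 0.
Hypothesis eC : forall j k, br (e j) (e k) = - br (e k) (e j).
Hypothesis eJ : forall i j k, br (e i) (br (e j) (e k))
  + br (e j) (br (e k) (e i)) + br (e k) (br (e i) (e j)) = 0.

Let brDl x a u v : br (a *: u + v) x = a *: br u x + br v x.
Proof. exact: brl. Qed.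
Let brDr x a u v : br x (a *: u + v) = a *: br x u + br x v.
Proof. exact: brr. Qed.
Let br0l x : br 0 x = 0.
Proof. by have := brDl x (-1) 0 0; rewrite scaler0 addr0 scaleN1r addNr. Qed.
Let br0r x : br x 0 = 0.
Proof. by have := brDr x (-1) 0 0; rewrite scaler0 addr0 scaleN1r addNr. Qed.

Lemma span_br_anti u v : br u v = - br v u.
Proof.
elim/span_ind: u => [|a j u IHu]; first by rewrite br0l br0r oppr0.
rewrite brDl brDr opprD IHu; congr (_ + _); rewrite -scalerN; congr (_ *: _).
elim/span_ind: v {IHu} => [|b k v IHv]; first by rewrite br0l br0r oppr0.
by rewrite brDl brDr opprD IHv eC scalerN.
Qed.

Lemma span_br_xx u : br u u = 0.
Proof.
elim/span_ind: u => [|a j u IHu]; first by rewrite br0l.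
rewrite brDl !brDr IHu ekk scaler0 add0r addr0.
by rewrite (span_br_anti u) scalerN addrN.
Qed.

Lemma span_br_jacobi u v w :
  br u (br v w) + br v (br w u) + br w (br u v) = 0.
Proof.
elim/span_ind: u => [|a i u IHu]; first by rewrite !(br0l, br0r) !addr0.
rewrite !(brDl, brDr) (addrACA (a *: _)) (addrACA (a *: _ + _)) {}IHu addr0.
rewrite -!scalerDr; apply/eqP; rewrite scaler_eq0; apply/orP; right; apply/eqP.
elim/span_ind: v => [|b j v IHv]; first by rewrite !(br0l, br0r) !addr0.
rewrite !(brDl, brDr) (addrACA (b *: _)) (addrACA (b *: _ + _)) {}IHv addr0.
rewrite -!scalerDr; apply/eqP; rewrite scaler_eq0; apply/orP; right; apply/eqP.
elim/span_ind: w => [|c k w IHw]; first by rewrite !(br0l, br0r) !addr0.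
rewrite !(brDl, brDr) (addrACA (c *: _)) (addrACA (c *: _ + _)) {}IHw addr0.
rewrite -!scalerDr; apply/eqP; rewrite scaler_eq0; apply/orP; right; apply/eqP.
exact: eJ.
Qed.

End Bracket.

Section MalgBracket.
Context (K : fieldType) (T : choiceType) (f : T -> T -> {malg K[T]}).
Hypothesis fkk : forall k, f k k = 0.
Hypothesis fC : forall j k, f j k = - f k j.
Hypothesis fJ : forall i j k, bilin_ext f << i >> (f j k)
  + bilin_ext f << j >> (f k i) + bilin_ext f << k >> (f i j) = 0.

Lemma malg_br_xx u : bilin_ext f u u = 0.
Proof.
apply: (span_br_xx (@malg_ind K T) (bilin_ext_linearl f)
  (bilin_ext_linearr f)) => [k|j k].
  by rewrite bilin_extU fkk.
by rewrite !bilin_extU fC.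
Qed.

Lemma malg_br_jacobi u v w : bilin_ext f u (bilin_ext f v w)
  + bilin_ext f v (bilin_ext f w u) + bilin_ext f w (bilin_ext f u v) = 0.
Proof.
apply: (span_br_jacobi (@malg_ind K T) (bilin_ext_linearl f)
  (bilin_ext_linearr f)) => i j k.
by rewrite (bilin_extU f j) (bilin_extU f k) (bilin_extU f i) fJ.
Qed.

End MalgBracket.

Section Group.
Context (K : fieldType) (G : zmodClosed K).

Definition grp : Type := {x : K | x \in G}.

HB.instance Definition _ := SubChoice.on grp.
HB.instance Definition _ := [SubChoice_isSubZmodule of grp by <:].

(** The element [xi * a] of [G]. The default value [0] is only reached if
    [xi * a] does not lie in [G]. *)
Definition gscale (xi : K) (a : grp) : grp := insubd 0 (xi * val a).

(** The coordinate functions [zcoord] are determined by the vectors [zvec]. *)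
Record zbasis (n : nat) := ZBasis {
  zvec :> 'I_n -> grp;
  zcoord : grp -> 'I_n -> int;
  zcoord_sum : forall a, a = \sum_i zvec i *~ zcoord a i;
  zcoord_uniq : forall (c : 'I_n -> int) i,
    zcoord (\sum_j zvec j *~ c j) i = c i }.

Lemma zcoordD n (B : zbasis n) a b i :
  zcoord B (a + b) i = zcoord B a i + zcoord B b i.
Proof.
rewrite {1}(zcoord_sum B a) {1}(zcoord_sum B b) -big_split /=.
under eq_bigr do rewrite -mulrzDr.
exact: (zcoord_uniq B (fun j => zcoord B a j + zcoord B b j)).
Qed.

Lemma zcoordN n (B : zbasis n) a i : zcoord B (- a) i = - zcoord B a i.
Proof.
apply/eqP; rewrite -addr_eq0 -zcoordD addNr.
have := zcoord_uniq B (fun=> 0) i; rewrite big1 => [->//|j _].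
by rewrite mulr0z.
Qed.

End Group.

Section Jacobi.
Context (K : fieldType) (G : zmodClosed K) (lambda : K) (W : lmodType K).
Local Notation gr := (grp G).
Variables (br : W -> W -> W) (L I : gr -> W) (pLL pLI pII : gr -> gr -> W).
Hypothesis brD : forall u v w, br u (v + w) = br u v + br u w.
Hypothesis brZ : forall u a v, br u (a *: v) = a *: br u v.
Hypothesis pLL_central : forall u a b, br u (pLL a b) = 0.
Hypothesis pLI_central : forall u a b, br u (pLI a b) = 0.
Hypothesis pII_central : forall u a b, br u (pII a b) = 0.
Hypothesis brLL : forall a b,
  br (L a) (L b) = (val b - val a) *: L (a + b) + pLL a b.
Hypothesis brLI : forall a b,
  br (L a) (I b) = (val b - lambda * val a) *: I (a + b) + pLI a b.
Hypothesis brIL : forall a b, br (I b) (L a) = - br (L a) (I b).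
Hypothesis brII : forall a b, br (I a) (I b) = pII a b.

Let brN u v : br u (- v) = - br u v.
Proof. by rewrite -[- v]scaleN1r brZ scaleN1r. Qed.
Let valD (a b : gr) : val (a + b) = val a + val b. Proof. by []. Qed.
Let J x y z := br x (br y z) + br y (br z x) + br z (br x y).

Let combine (v : W) x1 x2 x3 P1 P2 P3 :
  x1 + x2 + x3 = 0 -> P1 + P2 + P3 = 0 ->
  (x1 *: v + P1) + (x2 *: v + P2) + (x3 *: v + P3) = 0.
Proof.
move=> x0 P0; rewrite (addrACA (x1 *: v)) (addrACA (x1 *: v + _)) P0 addr0.
by rewrite -!scalerDl x0 scale0r.
Qed.

Lemma jacobi_LLL (a b c : gr) :
  (val c - val b) *: pLL a (b + c) + (val a - val c) *: pLL b (c + a)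
    + (val b - val a) *: pLL c (a + b) = 0 ->
  J (L a) (L b) (L c) = 0.
Proof.
rewrite /J !brLL !brD !brZ !pLL_central !addr0 !brLL !scalerDr !scalerA.
rewrite (_ : b + (c + a) = a + (b + c)); last by rewrite addrA addrC.
rewrite (_ : c + (a + b) = a + (b + c)); last by rewrite addrC addrA.
move=> p0; apply: combine => //; rewrite !valD; ring.
Qed.

Lemma jacobi_LLI (a b c : gr) :
  (val c - lambda * val b) *: pLI a (b + c)
    - (val c - lambda * val a) *: pLI b (a + c)
    - (val b - val a) *: pLI (a + b) c = 0 ->
  J (L a) (L b) (I c) = 0.
Proof.
rewrite /J brIL !brLI brLL brN !brD !brZ !pLI_central !pLL_central !addr0.
rewrite !brIL !brLI !scalerN -!scaleNr !scalerDr !scalerA.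
rewrite (_ : b + (a + c) = a + (b + c)) ?[b + _]addrCA // -[a + b + c]addrA.
move=> p0; apply: combine => //; rewrite !valD; ring.
Qed.

Lemma jacobi_LII (a b c : gr) :
  (val b - lambda * val a) *: pII c (a + b)
    - (val c - lambda * val a) *: pII b (a + c) = 0 ->
  J (L a) (I b) (I c) = 0.
Proof.
rewrite /J brIL !brLI brII brN !brD !brZ pII_central !pLI_central !addr0 add0r.
by rewrite !brII addrC.
Qed.

Lemma jacobi_III (a b c : gr) : J (I a) (I b) (I c) = 0.
Proof. by rewrite /J !brII !pII_central !addr0. Qed.

Lemma jacobi_rot u v w : J u v w = 0 -> J v w u = 0.
Proof. by move=> <-; rewrite /J addrC addrA. Qed.

Definition jacobi_vec (k : gr + gr) : W :=
  match k with inl a => L a | inr a => I a end.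

Lemma jacobi_vecP :
  (forall a b c : gr,
    (val c - val b) *: pLL a (b + c) + (val a - val c) *: pLL b (c + a)
      + (val b - val a) *: pLL c (a + b) = 0) ->
  (forall a b c : gr,
    (val c - lambda * val b) *: pLI a (b + c)
      - (val c - lambda * val a) *: pLI b (a + c)
      - (val b - val a) *: pLI (a + b) c = 0) ->
  (forall a b c : gr,
    (val b - lambda * val a) *: pII c (a + b)
      - (val c - lambda * val a) *: pII b (a + c) = 0) ->
  forall i j k, J (jacobi_vec i) (jacobi_vec j) (jacobi_vec k) = 0.
Proof.
move=> pLLP pLIP pIIP [] a [] b [] c /=.
- exact/jacobi_LLL/pLLP.
- exact/jacobi_LLI/pLIP.
- exact/jacobi_rot/jacobi_LLI/pLIP.
- exact/jacobi_LII/pIIP.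
- exact/jacobi_rot/jacobi_rot/jacobi_LLI/pLIP.
- exact/jacobi_rot/jacobi_rot/jacobi_LII/pIIP.
- exact/jacobi_rot/jacobi_LII/pIIP.
- exact: jacobi_III.
Qed.

End Jacobi.

Section Witt.
Context (K : fieldType) (G : zmodClosed K) (lambda : K).
Local Notation gr := (grp G).

(** The basis of g(G, lambda): [inl a] indexes [L_a], [inr a] indexes [I_a]. *)
Definition witt_idx : Type := (gr + gr)%type.
HB.instance Definition _ := Choice.on witt_idx.

Definition witt_br (j k : witt_idx) : {malg K[witt_idx]} :=
  match j, k with
  | inl a, inl b => (val b - val a) *: << inl (a + b) >>
  | inl a, inr b => (val b - lambda * val a) *: << inr (a + b) >>
  | inr b, inl a => - ((val b - lambda * val a) *: << inr (a + b) >>)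
  | inr _, inr _ => 0
  end.

Lemma witt_br_xx k : witt_br k k = 0.
Proof. by case: k => a //=; rewrite subrr scale0r. Qed.

Lemma witt_brC j k : witt_br j k = - witt_br k j.
Proof.
case: j k => a [] b /=; rewrite ?opprK ?oppr0 //.
by rewrite [b + a]addrC -scaleNr opprB.
Qed.

Lemma witt_br_jacobi i j k :
  bilin_ext witt_br << i >> (witt_br j k)
    + bilin_ext witt_br << j >> (witt_br k i)
    + bilin_ext witt_br << k >> (witt_br i j) = 0.
Proof.
rewrite -(bilin_extU witt_br j) -(bilin_extU witt_br k) -(bilin_extU witt_br i).
pose p0 (_ _ : gr) : {malg K[witt_idx]} := 0.
pose L a : {malg K[witt_idx]} := << inl a >>.
pose I a : {malg K[witt_idx]} := << inr a >>.
have p0P u a b : bilin_ext witt_br u (p0 a b) = 0 by exact: bilin_ext0r.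
have eE l : << l >> = jacobi_vec L I l by case: l.
rewrite !eE; apply: (@jacobi_vecP K G lambda _ _ L I p0 p0 p0) => //.
- by move=> *; exact: bilin_extDr.
- by move=> *; exact: bilin_extZr.
- by move=> *; rewrite addr0; exact: bilin_extU.
- by move=> *; rewrite addr0; exact: bilin_extU.
- move=> a b; apply: (etrans (bilin_extU witt_br (inr b) (inl a))).
  apply: (etrans (witt_brC _ _)); congr (- _); apply: esym.
  exact: (bilin_extU witt_br (inl a) (inr b)).
- by move=> *; exact: bilin_extU.
- by move=> *; rewrite /p0 !scaler0 !addr0.
- by move=> *; rewrite /p0 !scaler0 !subr0.
- by move=> *; rewrite /p0 !scaler0 !subr0.
Qed.

End Witt.

Definition witt (K : fieldType) (G : zmodClosed K) (lambda : K) : Type :=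
  {malg K[witt_idx G]}.

HB.instance Definition _ (K : fieldType) (G : zmodClosed K) (lambda : K) :=
  GRing.Lmodule.on (witt G lambda).
HB.instance Definition _ (K : fieldType) (G : zmodClosed K) (lambda : K) :=
  Lmodule_isLie.Build K (witt G lambda)
    (bilin_ext_linearl (witt_br lambda)) (bilin_ext_linearr (witt_br lambda))
    (malg_br_xx (witt_br_xx lambda) (witt_brC lambda))
    (malg_br_jacobi (witt_br_jacobi lambda)).

Definition wL (K : fieldType) (G : zmodClosed K) (lambda : K) (a : grp G) :
  witt G lambda := << inl a >>.
Definition wI (K : fieldType) (G : zmodClosed K) (lambda : K) (a : grp G) :
  witt G lambda := << inr a >>.

(** For [lambda != -1], the algebra [uce] below is the universal central
    extension of g(G, lambda), in its explicit presentation by a basis and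
    brackets. Its universal property is not proved in this file. *)

(** Names of the central elements. [CLI2 i] stands for [C_LI^(i + 2)], because
    ['I_n] is numbered from 0. *)
Inductive central (n : nat) := CL | CI | CLI0 | CLI1 | CLI2 of 'I_n.
Arguments CL {n}.
Arguments CI {n}.
Arguments CLI0 {n}.
Arguments CLI1 {n}.

Definition central_code n (c : central n) : 'I_4 + 'I_n :=
  match c with
  | CL => inl 0 | CI => inl 1 | CLI0 => inl 2%:R | CLI1 => inl 3%:R
  | CLI2 i => inr i
  end.
Definition central_decode n (c : 'I_4 + 'I_n) : central n :=
  match c with
  | inl i => nth CL [:: CL; CI; CLI0; CLI1] i
  | inr i => CLI2 i
  end.
Lemma central_codeK n : cancel (@central_code n) (@central_decode n).
Proof. by case. Qed.
HB.instance Definition _ n :=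
  Choice.copy (central n) (can_type (@central_codeK n)).

Definition present (K : fieldType) (lambda : K) n (c : central n) : bool :=
  match c with
  | CL => true
  | CI | CLI0 => lambda == 0
  | CLI1 => lambda == 1
  | CLI2 _ => lambda == -2
  end.

Lemma lincomb3_eq0 (K : fieldType) (V : lmodType K) n (u v : V) (w : 'I_n -> V)
    (x y z p p' p'' q q' q'' : K) (r r' r'' : 'I_n -> K) :
  x * p + y * p' + z * p'' = 0 -> x * q + y * q' + z * q'' = 0 ->
  (forall i, x * r i + y * r' i + z * r'' i = 0) ->
  x *: (p *: u + q *: v + \sum_i r i *: w i)
    + y *: (p' *: u + q' *: v + \sum_i r' i *: w i)
    + z *: (p'' *: u + q'' *: v + \sum_i r'' i *: w i) = 0.
Proof.
pose L a b c : V := a *: u + b *: v + \sum_i c i *: w i.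
rewrite -/(L p q r) -/(L p' q' r') -/(L p'' q'' r'').
have LZ k a b c : k *: L a b c = L (k * a) (k * b) (fun i => k * c i).
  rewrite /L !scalerDr !scalerA scaler_sumr; congr (_ + _).
  by apply: eq_bigr => i _; rewrite scalerA.
have LD a b c a' b' c' :
    L a b c + L a' b' c' = L (a + a') (b + b') (fun i => c i + c' i).
  rewrite /L addrACA [X in X + _ = _]addrACA -!scalerDl -big_split /=.
  by congr (_ + _); apply: eq_bigr => i _; rewrite scalerDl.
move=> p0 q0 r0; rewrite !LZ !LD p0 q0 /L !scale0r !add0r.
by rewrite big1 // => i _; rewrite r0 scale0r.
Qed.

Section Uce.
Context (K : numFieldType) (G : zmodClosed K) (n : nat).
Context (B : zbasis G n.+1) (lambda : K).
Local Notation gr := (grp G).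

Definition uce_idx : Type :=
  (witt_idx G + {c : central n | present lambda c})%type.
HB.instance Definition _ := Choice.on uce_idx.

Local Notation free := {malg K[uce_idx]}.

(** The central element [c], or [0] if [c] does not occur for this [lambda]. *)
Definition uce_C (c : central n) : free :=
  if insub c is Some k then << inr k >> else 0.

Definition cocycleLL (a b : gr) : free :=
  (12^-1 * (val a ^+ 3 - val a) * (a + b == 0)%:R) *: uce_C CL.

Definition cocycleII (a b : gr) : free :=
  (val a * (a + b == 0)%:R * (lambda == 0)%:R) *: uce_C CI.

(** The basis vector with number [1] is [B ord0], so that [lift ord0 i] is the
    number [i + 2]. *)
Definition cocycleLI (a b : gr) : free :=
  (a + b == 0)%:R *:
    (((val a ^+ 2 + val a) * (lambda == 0)%:R) *: uce_C CLI0
     + (12^-1 * (val a ^+ 3 - val a) * (lambda == 1)%:R) *: uce_C CLI1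
     + \sum_(i < n) ((zcoord B a (lift ord0 i))%:~R * (lambda == -2)%:R)
                    *: uce_C (CLI2 i)).

Definition uce_br (j k : uce_idx) : free :=
  match j, k with
  | inl (inl a), inl (inl b) =>
      (val b - val a) *: << inl (inl (a + b)) >> + cocycleLL a b
  | inl (inl a), inl (inr b) =>
      (val b - lambda * val a) *: << inl (inr (a + b)) >> + cocycleLI a b
  | inl (inr b), inl (inl a) =>
      - ((val b - lambda * val a) *: << inl (inr (a + b)) >> + cocycleLI a b)
  | inl (inr a), inl (inr b) => cocycleII a b
  | _, _ => 0
  end.

Let val_opp (a b : gr) : a + b = 0 -> val b = - val a.
Proof. by move/eqP; rewrite addrC addr_eq0 => /eqP ->. Qed.

Let cocycleLLC a b : cocycleLL a b = - cocycleLL b a.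
Proof.
rewrite /cocycleLL -[RHS]scaleNr [b + a]addrC; congr (_ *: _).
by case: eqP => [/val_opp->|_]; rewrite /=; ring.
Qed.

Let cocycleIIC a b : cocycleII a b = - cocycleII b a.
Proof.
rewrite /cocycleII -[RHS]scaleNr [b + a]addrC; congr (_ *: _).
by case: eqP => [/val_opp->|_]; rewrite /=; ring.
Qed.

Lemma uce_brC j k : uce_br j k = - uce_br k j.
Proof.
case: j k => [[a|a]|j] [[b|b]|k] /=;
  rewrite ?oppr0 ?opprK //.
by rewrite opprD -scaleNr opprB [b + a]addrC -cocycleLLC.
Qed.

Lemma uce_br_xx k : uce_br k k = 0.
Proof.
have self_opp (u : free) : u = - u -> u = 0.
  move=> /eqP; rewrite -addr_eq0 -mulr2n -scaler_nat scaler_eq0 pnatr_eq0 /=.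
  by move/eqP.
exact/self_opp/uce_brC.
Qed.

Local Notation br := (bilin_ext uce_br).

Lemma uce_br_C u c : br u (uce_C c) = 0.
Proof.
rewrite /uce_C; case: insubP => [k _ _|_]; last exact: bilin_ext0r.
elim/malg_ind: u => [|x i u IHu]; first exact: bilin_ext0l.
rewrite bilin_ext_linearl IHu addr0 bilin_extU.
by case: i => [[]|] *; apply: scaler0.
Qed.

Let cocycleLL_central u a b : br u (cocycleLL a b) = 0.
Proof. by rewrite bilin_extZr uce_br_C scaler0. Qed.

Let cocycleII_central u a b : br u (cocycleII a b) = 0.
Proof. by rewrite bilin_extZr uce_br_C scaler0. Qed.

Let cocycleLI_central u a b : br u (cocycleLI a b) = 0.
Proof.
rewrite bilin_extZr !bilin_extDr !bilin_extZr !uce_br_C !scaler0 !add0r.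
suff -> : br u (\sum_(i < n) ((zcoord B a (lift ord0 i))%:~R
    * (lambda == -2)%:R) *: uce_C (CLI2 i)) = 0 by apply: scaler0.
elim/big_rec: _ => [|i v _ IHv]; first exact: bilin_ext0r.
by rewrite bilin_extDr IHv addr0 bilin_extZr uce_br_C scaler0.
Qed.

Let sum3 (a b c : gr) : a + b + c = 0 -> val c = - (val a + val b).
Proof. by move/val_opp. Qed.

Let cocycleLLP (a b c : gr) :
  (val c - val b) *: cocycleLL a (b + c) + (val a - val c) *: cocycleLL b (c + a)
    + (val b - val a) *: cocycleLL c (a + b) = 0.
Proof.
rewrite /cocycleLL [b + (c + a)]addrA [b + c + a]addrC [c + (a + b)]addrC.
rewrite [a + (b + c)]addrA !scalerA -!scalerDl.
rewrite -[RHS](scale0r (uce_C CL)); congr (_ *: _).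
by case: eqP => [/sum3->|_]; rewrite /=; ring.
Qed.

Let cocycleIIP (a b c : gr) :
  (val b - lambda * val a) *: cocycleII c (a + b)
    - (val c - lambda * val a) *: cocycleII b (a + c) = 0.
Proof.
rewrite /cocycleII [c + (a + b)]addrC [b + (a + c)]addrCA [a + (b + c)]addrA.
rewrite !scalerA -scalerBl -[RHS](scale0r (uce_C CI)); congr (_ *: _).
case: eqP => [/sum3->|_]; last by rewrite /=; ring.
by case: (eqVneq lambda 0) => [->|_]; rewrite /=; ring.
Qed.

Let cocycleLIP (a b c : gr) :
  (val c - lambda * val b) *: cocycleLI a (b + c)
    - (val c - lambda * val a) *: cocycleLI b (a + c)
    - (val b - val a) *: cocycleLI (a + b) c = 0.
Proof.
rewrite /cocycleLI [b + (a + c)]addrCA [a + (b + c)]addrA.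
case: eqP => [/sum3 c_|_]; last by rewrite !scale0r !scaler0 !subr0.
rewrite !scale1r -(scaleNr (val c - _)) -(scaleNr (val b - _)).
apply: lincomb3_eq0 => [||i]; rewrite ?zcoordD ?rmorphD c_ /=.
- by case: (eqVneq lambda 0) => [->|_]; rewrite /=; ring.
- by case: (eqVneq lambda 1) => [->|_]; rewrite /=; ring.
- by case: (eqVneq lambda (-2)) => [->|_]; rewrite /=; ring.
Qed.

Lemma uce_br_jacobi i j k :
  br << i >> (uce_br j k) + br << j >> (uce_br k i) + br << k >> (uce_br i j)
    = 0.
Proof.
have br_c u c : br u << inr c >> = 0.
  have := uce_br_C u (val c); rewrite /uce_C.
  by case: insubP => [d _ /val_inj -> //|/negP[]]; apply: valP.
have brc_ u c : br << inr c >> u = 0.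
  elim/malg_ind: u => [|x l u IHu]; first exact: bilin_ext0r.
  rewrite bilin_ext_linearr IHu addr0 bilin_extU.
  by case: l => [[]|] *; apply: scaler0.
have br_br_c u v c : br u (br v << inr c >>) = 0.
  by rewrite br_c; exact: bilin_ext0r.
have br_brc_ u v c : br u (br << inr c >> v) = 0.
  by rewrite brc_; exact: bilin_ext0r.
have sum0 (u v w : free) : u = 0 -> v = 0 -> w = 0 -> u + v + w = 0.
  by move=> -> -> ->; rewrite !addr0.
rewrite -(bilin_extU uce_br j) -(bilin_extU uce_br k) -(bilin_extU uce_br i).
case: i => [i|c]; last first.
  exact: sum0 (brc_ _ _) (br_br_c _ _ _) (br_brc_ _ _ _).
case: j => [j|c]; last first.
  exact: sum0 (br_brc_ _ _ _) (brc_ _ _) (br_br_c _ _ _).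
case: k => [k|c]; last first.
  exact: sum0 (br_br_c _ _ _) (br_brc_ _ _ _) (brc_ _ _).
pose L a : free := << inl (inl a) >>.
pose I a : free := << inl (inr a) >>.
have eE l : << inl l >> = jacobi_vec L I l by case: l.
rewrite !eE.
have brLL a b : br (L a) (L b) = (val b - val a) *: L (a + b) + cocycleLL a b.
  exact: bilin_extU.
have brLI a b :
    br (L a) (I b) = (val b - lambda * val a) *: I (a + b) + cocycleLI a b.
  exact: bilin_extU.
have brIL a b : br (I b) (L a) = - br (L a) (I b).
  apply: (etrans (bilin_extU uce_br (inl (inr b)) (inl (inl a)))).
  apply: (etrans (uce_brC _ _)); congr (- _); apply: esym.
  exact: (bilin_extU uce_br (inl (inl a)) (inl (inr b))).
have brII a b : br (I a) (I b) = cocycleII a b by exact: bilin_extU.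
have brD u v w : br u (v + w) = br u v + br u w by exact: bilin_extDr.
have brZ u x v : br u (x *: v) = x *: br u v by exact: bilin_extZr.
exact: (jacobi_vecP brD brZ cocycleLL_central cocycleLI_central
  cocycleII_central brLL brLI brIL brII cocycleLLP cocycleLIP cocycleIIP).
Qed.

End Uce.

Definition uce (K : numFieldType) (G : zmodClosed K) n (B : zbasis G n.+1)
  (lambda : K) : Type := {malg K[uce_idx G n lambda]}.

HB.instance Definition _ (K : numFieldType) (G : zmodClosed K) n
    (B : zbasis G n.+1) (lambda : K) :=
  GRing.Lmodule.on (uce B lambda).
HB.instance Definition _ (K : numFieldType) (G : zmodClosed K) n
    (B : zbasis G n.+1) (lambda : K) :=
  Lmodule_isLie.Build K (uce B lambda)
    (bilin_ext_linearl (@uce_br K G n B lambda))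
    (bilin_ext_linearr (@uce_br K G n B lambda))
    (malg_br_xx (@uce_br_xx _ _ _ B lambda) (@uce_brC _ _ _ B lambda))
    (malg_br_jacobi (@uce_br_jacobi K G n B lambda)).

Section Elements.
Context (K : numFieldType) (G : zmodClosed K) (n : nat).
Context (B : zbasis G n.+1) (lambda : K).

Definition uL (a : grp G) : uce B lambda := << inl (inl a) >>.
Definition uI (a : grp G) : uce B lambda := << inl (inr a) >>.
Definition uC (c : central n) : uce B lambda := uce_C G lambda c.

Definition covering (u : uce B lambda) : witt G lambda :=
  lin_ext (fun k => if k is inl j then << j >> : witt G lambda else 0) u.

Lemma lie_wLL (a b : grp G) : lie (wL lambda a) (wL lambda b)
  = (val b - val a) *: wL lambda (a + b).
Proof. exact: (bilin_extU (witt_br lambda) (inl a) (inl b)). Qed.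

Lemma lie_wLI (a b : grp G) : lie (wL lambda a) (wI lambda b)
  = (val b - lambda * val a) *: wI lambda (a + b).
Proof. exact: (bilin_extU (witt_br lambda) (inl a) (inr b)). Qed.

Lemma lie_wII (a b : grp G) : lie (wI lambda a) (wI lambda b) = 0.
Proof. exact: (bilin_extU (witt_br lambda) (inr a) (inr b)). Qed.

Lemma lie_uLL (a b : grp G) : lie (uL a) (uL b) = (val b - val a) *: uL (a + b)
  + (12^-1 * (val a ^+ 3 - val a) * (a + b == 0)%:R) *: uC CL.
Proof. exact: (bilin_extU (@uce_br K G n B lambda) (inl (inl a)) (inl (inl b))). Qed.

Lemma lie_uII (a b : grp G) : lie (uI a) (uI b)
  = (val a * (a + b == 0)%:R * (lambda == 0)%:R) *: uC CI.
Proof. exact: (bilin_extU (@uce_br K G n B lambda) (inl (inr a)) (inl (inr b))). Qed.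

Lemma lie_uLI (a b : grp G) : lie (uL a) (uI b)
  = (val b - lambda * val a) *: uI (a + b) + (a + b == 0)%:R *:
    (((val a ^+ 2 + val a) * (lambda == 0)%:R) *: uC CLI0
     + (12^-1 * (val a ^+ 3 - val a) * (lambda == 1)%:R) *: uC CLI1
     + \sum_(i < n) ((zcoord B a (lift ord0 i))%:~R * (lambda == -2)%:R)
                    *: uC (CLI2 i)).
Proof. exact: (bilin_extU (@uce_br K G n B lambda) (inl (inl a)) (inl (inr b))). Qed.

Lemma lie_uC u c : lie u (uC c) = 0.
Proof. exact: uce_br_C. Qed.

Lemma covering_linear : linear covering.
Proof. exact: lin_ext_linear. Qed.

Lemma covering_uL (a : grp G) : covering (uL a) = wL lambda a.
Proof. exact: lin_extU. Qed.

Lemma covering_uI (a : grp G) : covering (uI a) = wI lambda a.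
Proof. exact: lin_extU. Qed.

Lemma covering_uC c : covering (uC c) = 0.
Proof.
rewrite /covering /uC /uce_C; case: insubP => [k _ _|_].
  exact: lin_extU.
by rewrite /lin_ext msupp0 big_seq_fset0.
Qed.

Lemma covering_hom : lie_hom covering.
Proof.
have lc := covering_linear; split=> // x y.
have E := @eq_linear_malg K (uce_idx G n lambda) (witt G lambda).
refine (E (fun x => covering (lie (x : uce B lambda) y))
  (fun x => lie (covering x) (covering y)) _ _ _ x).
- by move=> a u v; rewrite lie_linearl lc.
- by move=> a u v; rewrite lc lie_linearl.
move=> j.
refine (E (fun y => covering (lie (<< j >> : uce B lambda) (y : uce B lambda)))
  (fun y => lie (covering << j >>) (covering y)) _ _ _ y).
- by move=> a u v; rewrite lie_linearr lc.
- by move=> a u v; rewrite lc lie_linearr.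
move=> k.
have lie0r (v : witt G lambda) : lie v 0 = 0.
  by have := lie_linearr v (-1) 0 0; rewrite scaler0 addr0 scaleN1r addNr.
have c0 : covering 0 = 0.
  by have := lc (-1) 0 0; rewrite scaler0 addr0 scaleN1r addNr.
have cZ a u : covering (a *: u) = a *: covering u.
  by have := lc a u 0; rewrite c0 !addr0.
have cN u : covering (- u) = - covering u by rewrite -scaleN1r cZ scaleN1r.
have cD u v : covering (u + v) = covering u + covering v.
  by have := lc 1 u v; rewrite !scale1r.
have cC a c : covering (a *: uC c) = 0 by rewrite cZ covering_uC scaler0.
have uCE (c : {c : central n | present lambda c}) :
    << inr c >> = uC (val c) :> uce B lambda.
  rewrite /uC /uce_C.
  by case: insubP => [d _ /val_inj -> //|/negP[]]; apply: valP.
have hLI (a b : grp G) :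
    covering (lie (uL a) (uI b)) = lie (covering (uL a)) (covering (uI b)).
  apply: etrans (esym (congr2 lie (covering_uL a) (covering_uI b))).
  rewrite lie_uLI lie_wLI cD cZ covering_uI cZ !cD !cC.
  rewrite (_ : covering (\sum_(i < n) _) = 0); last first.
    by elim/big_rec: _ => // i v _; rewrite cD cC add0r.
  by rewrite !addr0 scaler0 addr0.
case: k => [k|c]; last by rewrite uCE lie_uC covering_uC lie0r c0.
case: j => [j|c]; last first.
  by rewrite uCE lieC [RHS]lieC cN lie_uC covering_uC lie0r c0.
have hIL (a b : grp G) : covering (lie (uI a) (uL b))
    = lie (covering (uI a)) (covering (uL b)).
  by rewrite lieC [RHS]lieC cN hLI.
have hLL (a b : grp G) : covering (lie (uL a) (uL b))
    = lie (covering (uL a)) (covering (uL b)).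
  apply: etrans (esym (congr2 lie (covering_uL a) (covering_uL b))).
  by rewrite lie_uLL lie_wLL cD cC addr0 cZ covering_uL.
have hII (a b : grp G) : covering (lie (uI a) (uI b))
    = lie (covering (uI a)) (covering (uI b)).
  apply: etrans (esym (congr2 lie (covering_uI a) (covering_uI b))).
  by rewrite lie_uII lie_wII cC.
case: j k => a [] b.
- exact: hLL.
- exact: hLI.
- exact: hIL.
- exact: hII.
Qed.

Definition lifts_aut (theta : witt G lambda -> witt G lambda)
    (t : uce B lambda -> uce B lambda) : Prop :=
  lie_aut t /\ forall u, covering (t u) = theta (covering u).

End Elements.

(* Main.v *)
Require Import Defs.
From HB Require Import structures.
From mathcomp Require Import all_boot all_order all_algebra.
From mathcomp Require Import reals complex.
From mathcomp Require Import monalg ring.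
From mathcomp Require boolp.

Set Implicit Arguments.
Unset Strict Implicit.
Unset Printing Implicit Defensive.

Import GRing.Theory Num.Theory.
Local Open Scope ring_scope.

(** The extension of [theta] is forced. The algebra [uce B lambda] is perfect:
    the brackets [L_0, L_c], [L_{-1}, L_1], [L_{-1}, I_1] and a few others yield
    every basis vector, and this is where [lambda != -1] enters, because
    [L_{-1}, I_1] equals [(1 + lambda) I_0]. The kernel of the covering is
    central, so two homomorphisms that lift the same map differ by central
    values, have the same brackets of values, and hence agree on all brackets,
    that is, everywhere ([lie_hom_lift_uniq]).

    The formulas come from this: evaluating a lift on the brackets above gives
    the central corrections at [L_0] and [I_0] and then the images of the
    central elements. Conversely, the linear map [twist_lift] defined by these
    formulas is a homomorphism ([twist_lift_hom]). For [a + b != 0] this says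
    that [theta] is a homomorphism, which for the coefficient function [phi] of
    [I_{xi a}] amounts to the identity [twist_phi_cocycle]. For [a + b = 0] the
    central terms must match as well. If [lambda != 0], the identity makes
    [phi] odd; the cocycle of [L_a] and [I_b] is odd too, so the contribution of
    [phi] to the bracket of the images of [L_a] and [L_{-a}] cancels. If
    [lambda = 0], neither has to be odd, but [phi] is [l0 + l1 a], and what
    remains is accounted for by the corrections at [L_0] and [I_0] and by the
    extra terms in the image of [C_L]. If [lambda = -2], the matching of the
    [C_LI^(i)] is the additivity of [a |-> (xi a)_j - a (xi eps_1)_j], which
    vanishes at [eps_1 = 1] ([sum_zcoord_CLI2]).

    Bijectivity comes from the inverse of [theta]. It has the same shape, with
    explicit parameters ([twist_data_inv]), so it has a lift too; both
    composites of the two lifts lift the identity and are therefore the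
    identity ([twist_lift_cancel]). *)

(** * Bilinear and linear algebra *)

Section LieBilinearity.
Context (K : fieldType) (V : lieAlgType K).
Implicit Types u v w : V.

Lemma lieDl u v w : lie (u + v) w = lie u w + lie v w.
Proof. by have := lie_linearl w 1 u v; rewrite !scale1r. Qed.

Lemma lieDr u v w : lie u (v + w) = lie u v + lie u w.
Proof. by have := lie_linearr u 1 v w; rewrite !scale1r. Qed.

Lemma lie0l u : lie 0 u = 0.
Proof. by apply: (addrI (lie 0 u)); rewrite -lieDl !addr0. Qed.

Lemma lie0r u : lie u 0 = 0.
Proof. by rewrite lieC lie0l oppr0. Qed.

Lemma lieZl a u v : lie (a *: u) v = a *: lie u v.
Proof. by have := lie_linearl v a u 0; rewrite lie0l !addr0. Qed.

Lemma lieZr a u v : lie u (a *: v) = a *: lie u v.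
Proof. by rewrite lieC lieZl lieC scalerN opprK. Qed.

(** The arguments have the shape of the images of [L_a] and [L_b] under a lift,
    with central corrections [z] and [z']; the brackets of the leading terms
    are supplied as equations so that any presentation can be plugged in. *)
Lemma lie_pair_mod_center (x y x' y' : K) (u v u' v' z z' p q r s : V) :
  lie u u' = p -> lie u v' = q -> lie u' v = r -> lie v v' = s ->
  (forall w, lie w z = 0) -> (forall w, lie w z' = 0) ->
  lie (x *: u + y *: v + z) (x' *: u' + y' *: v' + z') =
    (x * x') *: p + (x * y') *: q - (x' * y) *: r + (y * y') *: s.
Proof.
move=> <- <- <- <- zc zc'; rewrite lieDr zc' addr0 lieC lieDr zc addr0 -lieC.
rewrite !lieDl !lieDr !lieZl !lieZr !scalerA [lie v u']lieC scalerN.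
by rewrite [y * x']mulrC !addrA.
Qed.

Lemma lie_pair_mod_center_r (x y y' : K) (u v v' z z' q s : V) :
  lie u v' = q -> lie v v' = s ->
  (forall w, lie w z = 0) -> (forall w, lie w z' = 0) ->
  lie (x *: u + y *: v + z) (y' *: v' + z') = (x * y') *: q + (y * y') *: s.
Proof.
move=> qE sE zc zc'; rewrite -[y' *: v']add0r -(scale0r u).
rewrite (lie_pair_mod_center _ _ _ _ (liexx u) qE erefl sE zc zc').
by rewrite scaler0 add0r mul0r scale0r subr0.
Qed.

End LieBilinearity.

Section LinearFun.
Context (K : fieldType) (V W : lmodType K) (t : V -> W).
Hypothesis t_lin : linear t.

Lemma lin0 : t 0 = 0.
Proof.
by have := t_lin (-1) 0 0; rewrite scaler0 addr0 scaleN1r addNr.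
Qed.

Lemma linD u v : t (u + v) = t u + t v.
Proof. by have := t_lin 1 u v; rewrite !scale1r. Qed.

Lemma linZ a u : t (a *: u) = a *: t u.
Proof. by have := t_lin a u 0; rewrite lin0 !addr0. Qed.

Lemma lin_sum (J : finType) (F : J -> V) : t (\sum_j F j) = \sum_j t (F j).
Proof. exact: (big_morph t linD lin0). Qed.

Lemma lin_comb2 a b u v : t (a *: u + b *: v) = a *: t u + b *: t v.
Proof. by rewrite linD !linZ. Qed.

End LinearFun.

(** Used with [u = L_a] and [v = I_a]: two maps that act on each such pair by
    triangular matrices compose to the identity on [L_a]. *)
Lemma unitriangular_cancel (K : fieldType) (V : lmodType K) (u v : V)
    (x y p q r : K) :
  x * p = 1 -> x * q + y * r = 0 ->
  x *: (p *: u + q *: v) + y *: (r *: v) = u.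
Proof.
move=> xp0 xq0; rewrite scalerDr !scalerA xp0 scale1r -addrA -scalerDl xq0.
by rewrite scale0r addr0.
Qed.

(** * The group of indices and the mixed cocycle *)

Section Formulas.
Context (K : numFieldType) (G : zmodClosed K) (n : nat).
Context (B : zbasis G n.+1) (lambda : K).

Lemma zcoord_basis m (A : zbasis G m) i j : zcoord A (A i) j = (j == i)%:R.
Proof.
rewrite -(zcoord_uniq A (fun k => (k == i)%:R)); congr (zcoord A _ j).
rewrite (bigD1 i) //= eqxx big1 ?addr0 // => k /negPf ->.
by rewrite mulr0z.
Qed.

Lemma gval0 : val (0 : grp G) = 0. Proof. by []. Qed.
Lemma gvalD (a b : grp G) : val (a + b) = val a + val b. Proof. by []. Qed.
Lemma gvalN (a : grp G) : val (- a) = - val a. Proof. by []. Qed.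
Definition gvalE := (gvalD, gvalN, gval0).

Section GscaleTheory.
Variable xi : K.
Hypothesis xiG : forall x, x \in G -> xi * x \in G.
Local Notation gs := (@gscale K G xi).

Lemma val_gscale a : val (gs a) = xi * val a.
Proof. by rewrite /gscale insubdK //; apply: xiG; apply: valP. Qed.

Lemma gscaleD a b : gs (a + b) = gs a + gs b.
Proof. by apply: val_inj; rewrite !(val_gscale, gvalD) mulrDr. Qed.

Lemma gscaleN a : gs (- a) = - gs a.
Proof. by apply: val_inj; rewrite !(val_gscale, gvalN) mulrN. Qed.

Lemma gscale0 : gs 0 = 0.
Proof. by apply: val_inj; rewrite val_gscale mulr0. Qed.

Lemma gscale_eq0 a : xi != 0 -> (gs a == 0) = (a == 0).
Proof.
move=> xi0; rewrite -val_eqE val_gscale gval0 mulf_eq0 (negPf xi0).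
by rewrite -[RHS](val_eqE a 0).
Qed.

End GscaleTheory.

Lemma lambda0_neq :
  lambda == 0 -> (lambda == 1 = false) * (lambda == -2 = false).
Proof.
by move=> /eqP ->; rewrite ![0 == _]eq_sym oner_eq0 oppr_eq0 pnatr_eq0.
Qed.

Lemma lambda1_neq :
  lambda == 1 -> (lambda == 0 = false) * (lambda == -2 = false).
Proof.
by move=> /eqP ->; rewrite oner_eq0 -addr_eq0 -mulrS pnatr_eq0.
Qed.

Lemma lambdaN2_neq :
  lambda == -2 -> (lambda == 0 = false) * (lambda == 1 = false).
Proof.
move=> /eqP ->; rewrite oppr_eq0 pnatr_eq0 (eq_sym (-2)).
by rewrite -addr_eq0 -mulrS pnatr_eq0.
Qed.

(** The central part of [[L_a, I_{-a}]], as a function of the values [C c] given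
    to the central symbols. A lift has to carry the cocycle for the old central
    elements to the cocycle for their images, which is the same expression with
    another [C]. *)
Definition LI_cocycle (V : lmodType K) (C : central n -> V) (a : grp G) : V :=
  ((val a ^+ 2 + val a) * (lambda == 0)%:R) *: C CLI0
  + (12^-1 * (val a ^+ 3 - val a) * (lambda == 1)%:R) *: C CLI1
  + \sum_(i < n) ((zcoord B a (lift ord0 i))%:~R * (lambda == -2)%:R)
                  *: C (CLI2 i).

Section CocycleCases.
Context (V : lmodType K) (C : central n -> V).

Lemma LI_cocycle_lambda0 a :
  lambda == 0 -> LI_cocycle C a = (val a ^+ 2 + val a) *: C CLI0.
Proof.
move=> l0; rewrite /LI_cocycle l0 !lambda0_neq // mulr0 scale0r addr0 mulr1.
by rewrite big1 ?addr0 // => i _; rewrite mulr0 scale0r.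
Qed.

Lemma LI_cocycle_lambda1 a :
  lambda == 1 -> LI_cocycle C a = (12^-1 * (val a ^+ 3 - val a)) *: C CLI1.
Proof.
move=> l1; rewrite /LI_cocycle l1 !lambda1_neq // mulr0 scale0r add0r mulr1.
by rewrite big1 ?addr0 // => i _; rewrite mulr0 scale0r.
Qed.

Lemma LI_cocycle_lambdaN2 a : lambda == -2 ->
  LI_cocycle C a = \sum_(i < n) (zcoord B a (lift ord0 i))%:~R *: C (CLI2 i).
Proof.
move=> l2; rewrite /LI_cocycle l2 !lambdaN2_neq // !mulr0 !scale0r !add0r.
by apply: eq_bigr => i _; rewrite mulr1.
Qed.

Lemma LI_cocycle_generic a :
  lambda != 0 -> lambda != 1 -> lambda != -2 -> LI_cocycle C a = 0.
Proof.
move=> /negPf l0 /negPf l1 /negPf l2.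
rewrite /LI_cocycle l0 l1 l2 !mulr0 !scale0r.
by rewrite !add0r big1 // => i _; rewrite mulr0 scale0r.
Qed.

(** For [lambda = 0] the cocycle [a ^+ 2 + a] has an even part. *)
Lemma LI_cocycle_opp a : lambda != 0 -> LI_cocycle C (- a) = - LI_cocycle C a.
Proof.
move=> l0N.
have [e1|n1] := boolP (lambda == 1).
  by rewrite !LI_cocycle_lambda1 // gvalN -scaleNr; congr (_ *: _); ring.
have [e2|n2] := boolP (lambda == -2).
  rewrite !LI_cocycle_lambdaN2 // -sumrN; apply: eq_bigr => i _.
  by rewrite zcoordN rmorphN scaleNr.
by rewrite !LI_cocycle_generic // oppr0.
Qed.

End CocycleCases.

(** * The formulas for a lift *)

(** The parameters of an automorphism of g(G, lambda) of the shape
    [L_a |-> xi^-1 chi(a) L_{xi a} + chi(a) phi(a) I_{xi a}],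
    [I_a |-> l chi(a) I_{xi a}]. The concrete [phi] enters only through
    [twist_phi_cocycle], which says that brackets of two [L]'s are preserved,
    and through its two coefficients for [lambda = 0]. In this form the class
    is closed under inverses without a description of the inverse of [phi] for
    each [lambda]. *)
Record twist_data (xi l0 l1 : K) (chi phi : grp G -> K) : Prop := TwistData {
  twist_xi_neq0 : xi != 0;
  twist_xiG : forall x, x \in G -> xi * x \in G;
  twist_chi0 : chi 0 = 1;
  twist_chiD : forall a b, chi (a + b) = chi a * chi b;
  twist_phi_cocycle : forall a b,
    phi b * (val b - lambda * val a) - phi a * (val a - lambda * val b)
      = (val b - val a) * phi (a + b);
  twist_phi_affine : lambda = 0 -> forall a, phi a = l0 + l1 * val a }.

Section Lift.
Variables (xi l l0 l1 : K) (chi phi : grp G -> K).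

Section Images.
Context (V : lmodType K) (L I : grp G -> V) (C : central n -> V).

(** The families [L], [I], [C] are arbitrary because the bracket identities for
    these images hold in every Lie algebra with the relations of [uce]; they
    are proved at that level. *)
Definition twist_L (a : grp G) : V :=
  (xi^-1 * chi a) *: L (gscale xi a) + (chi a * phi a) *: I (gscale xi a)
  + (a == 0)%:R *:
    (((xi^-1 - xi) / 24) *: C CL
     + ((l1 * xi - l0) * (lambda == 0)%:R) *: C CLI0
     + (2^-1 * xi * (l1 ^+ 2 - l0 ^+ 2) * (lambda == 0)%:R) *: C CI).

Definition twist_I (a : grp G) : V :=
  (l * chi a) *: I (gscale xi a)
  + (l * xi * (a == 0)%:R) *:
    (((xi^-1 - xi) / 24 * (lambda == 1)%:R) *: C CLI1
     + (lambda == 0)%:R *: ((1 - xi^-1) *: C CLI0 + (l1 - l0) *: C CI))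
  + (l * (xi * val (B ord0))^-1 * (a == 0)%:R) *:
    \sum_(i < n) ((zcoord B (gscale xi (B ord0)) (lift ord0 i))%:~R
                  * (lambda == -2)%:R) *: C (CLI2 i).

Definition twist_C (c : central n) : V :=
  match c with
  | CL => xi *: C CL
          - (12 * l1 * xi * (lambda == 0)%:R) *: (2 *: C CLI0 + l1 *: C CI)
  | CI => (l ^+ 2 * xi) *: C CI
  | CLI0 => (l * xi) *: (C CLI0 + l1 *: C CI)
  | CLI1 => (l * xi ^+ 2) *: C CLI1
  | CLI2 i => (l * (xi * val (B ord0))^-1) *:
      \sum_(j < n)
        (val (B ord0)
           * (zcoord B (gscale xi (B (lift ord0 i))) (lift ord0 j))%:~R
         - val (B (lift ord0 i))
           * (zcoord B (gscale xi (B ord0)) (lift ord0 j))%:~R)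
        *: C (CLI2 j)
  end.

Section ModuloCentral.
Context (W : lmodType K) (t : V -> W).
Hypothesis t_lin : linear t.
Hypothesis tC : forall c, t (C c) = 0.

Lemma twist_L_mod_C a : t (twist_L a)
  = (xi^-1 * chi a) *: t (L (gscale xi a))
    + (chi a * phi a) *: t (I (gscale xi a)).
Proof.
rewrite /twist_L !(linD t_lin, linZ t_lin) !tC.
by rewrite !scaler0 !addr0 scaler0 addr0.
Qed.

Lemma twist_I_mod_C a : t (twist_I a) = (l * chi a) *: t (I (gscale xi a)).
Proof.
rewrite /twist_I !(linD t_lin, linZ t_lin) !tC (lin_sum t_lin).
rewrite big1 => [|i _]; last by rewrite (linZ t_lin) tC scaler0.
by rewrite !(scaler0, addr0).
Qed.

Lemma twist_C_mod_C c : t (twist_C c) = 0.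
Proof.
case: c => [||||i]; rewrite /twist_C -?scaleNr.
- by rewrite !(linD t_lin, linZ t_lin) !tC !(scaler0, addr0).
- by rewrite (linZ t_lin) tC scaler0.
- by rewrite !(linD t_lin, linZ t_lin) !tC !(scaler0, addr0).
- by rewrite (linZ t_lin) tC scaler0.
- rewrite (linZ t_lin) (lin_sum t_lin) big1 ?scaler0 // => j _.
  by rewrite (linZ t_lin) tC scaler0.
Qed.

End ModuloCentral.
End Images.

Hypothesis D : twist_data xi l0 l1 chi phi.

Local Notation gs := (@gscale K G xi).

Let xiG := twist_xiG D.
Let val_gscale := val_gscale xiG.
Let gscaleD := gscaleD xiG.
Let gscaleN := gscaleN xiG.
Let gscale_eq0 a := gscale_eq0 xiG a (twist_xi_neq0 D).

Lemma chi_neq0 a : chi a != 0.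
Proof.
apply/eqP => a0; have := twist_chiD D a (- a).
by rewrite addrN (twist_chi0 D) a0 mul0r => /eqP; rewrite oner_eq0.
Qed.

Lemma chi_opp a : chi (- a) = (chi a)^-1.
Proof.
apply: (mulfI (chi_neq0 a)).
by rewrite -(twist_chiD D) addrN (twist_chi0 D) mulfV // chi_neq0.
Qed.

Hypothesis eps1 : val (B ord0) = 1.
Hypothesis lambda_neqN1 : lambda != -1.

(** Take [(0, 1)] in the cocycle identity to get [lambda * phi 0 = 0], and then
    [(a, - a)], where the identity reads
    [(1 + lambda) * val a * (phi (- a) + phi a) = 0]. *)
Lemma phi_opp a : lambda != 0 -> phi (- a) = - phi a.
Proof.
move=> l0N; have phi0 : phi 0 = 0.
  have := twist_phi_cocycle D 0 (B ord0).
  rewrite !add0r gval0 eps1 => /eqP; rewrite -subr_eq0 => /eqP E.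
  have : lambda * phi 0 = 0 by rewrite -E; ring.
  by move/eqP; rewrite mulf_eq0 (negPf l0N) => /eqP.
have [->|a0] := eqVneq a 0; first by rewrite oppr0 phi0 oppr0.
have := twist_phi_cocycle D a (- a); rewrite addrN phi0 mulr0 gvalN.
have -> : phi (- a) * (- val a - lambda * val a)
     - phi a * (val a - lambda * - val a)
   = - ((1 + lambda) * val a) * (phi (- a) + phi a) by ring.
move/eqP; rewrite mulf_eq0 oppr_eq0 mulf_eq0 addrC addr_eq0.
by rewrite (negPf lambda_neqN1) (val_eqE a 0) (negPf a0) addr_eq0 => /eqP.
Qed.

(** In such a space an identity between linear combinations may be tested on
    functionals, where it becomes an identity of scalars. *)
Definition functionals_separate (V : lmodType K) := forall u v : V,
  (forall p : V -> K, (forall x y, p (x + y) = p x + p y) ->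
     (forall x, p (- x) = - p x) -> (forall a x, p (a *: x) = a * p x) ->
     p u = p v) -> u = v.

Context (V : lieAlgType K) (L I : grp G -> V) (C : central n -> V).
Hypothesis V_sep : functionals_separate V.
Hypothesis lieLL : forall a b, lie (L a) (L b) = (val b - val a) *: L (a + b)
  + (12^-1 * (val a ^+ 3 - val a) * (a + b == 0)%:R) *: C CL.
Hypothesis lieLI : forall a b, lie (L a) (I b)
  = (val b - lambda * val a) *: I (a + b) + (a + b == 0)%:R *: LI_cocycle C a.
Hypothesis lieII : forall a b, lie (I a) (I b)
  = (val a * (a + b == 0)%:R * (lambda == 0)%:R) *: C CI.
Hypothesis lie_C : forall u c, lie u (C c) = 0.

Local Notation TL := (twist_L L I C).
Local Notation TI := (twist_I I C).
Local Notation TC := (twist_C C).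

Lemma lie_twist_L_tail w x y z :
  lie w (x *: C CL + y *: C CLI0 + z *: C CI) = 0.
Proof. by rewrite !lieDr !lieZr !lie_C !scaler0 !addr0. Qed.

Lemma lie_LI_pair (A A' : grp G) (x y x' y' : K) (z z' : V) :
  (forall v, lie v z = 0) -> (forall v, lie v z' = 0) ->
  lie (x *: L A + y *: I A + z) (x' *: L A' + y' *: I A' + z') =
    (x * x' * (val A' - val A)) *: L (A + A')
    + (x * y' * (val A' - lambda * val A)
       - x' * y * (val A - lambda * val A')) *: I (A + A')
    + (A + A' == 0)%:R *:
      ((x * x' * (12^-1 * (val A ^+ 3 - val A))) *: C CL
       + (x * y') *: LI_cocycle C A - (x' * y) *: LI_cocycle C A'
       + (y * y' * val A * (lambda == 0)%:R) *: C CI).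
Proof.
move=> zc zc'.
rewrite (lie_pair_mod_center _ _ _ _ (lieLL _ _) (lieLI _ _) (lieLI _ _)
  (lieII _ _) zc zc') (addrC A').
by apply: V_sep => p pD pN pZ; rewrite !(pD, pN, pZ); ring.
Qed.

(** The coefficients of [L] and [I] match for all [a] and [b]; central terms
    occur only for [b = - a]. There the twisted bracket has [C_L] coefficient
    [((xi a)^3 - xi a) / (12 xi^2)], and subtracting [xi (a^3 - a) / 12] leaves
    [- 2 a] times [(xi^-1 - xi) / 24], the correction of [L_0]. *)
Lemma lie_twist_LL a b : lie (TL a) (TL b) = (val b - val a) *: TL (a + b)
  + (12^-1 * (val a ^+ 3 - val a) * (a + b == 0)%:R) *: TC CL.
Proof.
have xi0 := twist_xi_neq0 D; have ca := chi_neq0 a.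
have zc (w : V) c x y z :
    lie w (c *: (x *: C CL + y *: C CLI0 + z *: C CI)) = 0.
  by rewrite lieZr lie_twist_L_tail scaler0.
rewrite lie_LI_pair // -gscaleD gscale_eq0 !val_gscale /twist_L.
have -> : xi^-1 * chi a * (xi^-1 * chi b) * (xi * val b - xi * val a)
    = (val b - val a) * (xi^-1 * chi (a + b)).
  by rewrite (twist_chiD D); field; rewrite ?xi0 ?ca.
have -> : xi^-1 * chi a * (chi b * phi b) * (xi * val b - lambda * (xi * val a))
    - xi^-1 * chi b * (chi a * phi a) * (xi * val a - lambda * (xi * val b))
    = (val b - val a) * (chi (a + b) * phi (a + b)).
  rewrite (mulrCA (val b - val a)) -(twist_phi_cocycle D) (twist_chiD D).
  by field; rewrite ?xi0 ?ca.
rewrite [X in _ = X + _]scalerDr [X in _ = X + _ + _]scalerDr !scalerA.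
rewrite -[RHS]addrA; congr (_ + _ + _).
have [ab0|ab0] := eqVneq (a + b) 0; last first.
  by rewrite !(mulr0, mul0r, scale0r, addr0).
have -> : b = - a by apply/eqP; rewrite -addr_eq0 addrC ab0.
rewrite chi_opp gscaleN gvalN.
have [l00|l0N] := eqVneq lambda 0.
  have l00' : lambda == 0 by apply/eqP.
  rewrite !LI_cocycle_lambda0 // gvalN !val_gscale !(twist_phi_affine D l00).
  rewrite gvalN /= l00' /=.
  by apply: V_sep => p pD pN pZ; rewrite !(pD, pN, pZ); field;
    rewrite ?xi0 ?ca.
(* Both [phi] and the cocycle are odd, so its two occurrences cancel. *)
rewrite LI_cocycle_opp // phi_opp //= (negPf l0N) /=.
by apply: V_sep => p pD pN pZ; rewrite !(pD, pN, pZ); field;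
  rewrite ?xi0 ?ca.
Qed.

Lemma twist_I_tail_central w x y :
  lie w (x *: (((xi^-1 - xi) / 24 * (lambda == 1)%:R) *: C CLI1
     + (lambda == 0)%:R *: ((1 - xi^-1) *: C CLI0 + (l1 - l0) *: C CI))
  + y *: \sum_(i < n) ((zcoord B (gs (B ord0)) (lift ord0 i))%:~R
                  * (lambda == -2)%:R) *: C (CLI2 i)) = 0.
Proof.
rewrite !(lieDr, lieZr, lie_C, scaler0, addr0, add0r).
elim/big_rec: _ => [|i u _ IHu]; first by rewrite lie0r scaler0.
by rewrite lieDr lieZr lie_C scaler0 add0r.
Qed.

Lemma lie_twist_II a b : lie (TI a) (TI b)
  = (val a * (a + b == 0)%:R * (lambda == 0)%:R) *: TC CI.
Proof.
have xi0 := twist_xi_neq0 D; have ca := chi_neq0 a.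
rewrite /twist_I -!addrA lieDr twist_I_tail_central addr0.
rewrite lieC lieDr twist_I_tail_central addr0 -lieC lieZl lieZr lieII !scalerA.
congr (_ *: _); rewrite -gscaleD gscale_eq0 val_gscale.
have [ab0|ab0] := eqVneq (a + b) 0; last by rewrite !(mulr0, mul0r).
have -> : b = - a by apply/eqP; rewrite -addr_eq0 addrC ab0.
by rewrite chi_opp; field; rewrite ?xi0 ?ca.
Qed.

(** The function [h a := (xi a)_j - a * (xi eps_1)_j] is additive and vanishes
    at [eps_1 = 1], so it is determined by its values at the other basis
    vectors, which are the coefficients of [TC (CLI2 i)]. *)
Lemma sum_zcoord_CLI2 (a : grp G) :
  \sum_(i < n) (zcoord B a (lift ord0 i))%:~R *: TC (CLI2 i)
  = (l * xi^-1) *: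
    (\sum_(j < n) (zcoord B (gs a) (lift ord0 j))%:~R *: C (CLI2 j)
     - val a *: \sum_(j < n) (zcoord B (gs (B ord0)) (lift ord0 j))%:~R
                  *: C (CLI2 j)).
Proof.
rewrite /= eps1 mulr1.
under eq_bigr => i _ do rewrite scalerA mulrC -scalerA scaler_sumr.
rewrite -scaler_sumr; congr (_ *: _).
rewrite exchange_big scaler_sumr -sumrB /=.
apply: eq_bigr => j _.
under eq_bigr => i _ do rewrite scalerA.
rewrite -scaler_suml scalerA -scalerBl; congr (_ *: _).
pose h (u : grp G) : K := (zcoord B (gs u) (lift ord0 j))%:~R
  - val u * (zcoord B (gs (B ord0)) (lift ord0 j))%:~R.
have hD u v : h (u + v) = h u + h v.
  by rewrite /h gscaleD zcoordD gvalD rmorphD /=; ring.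
have h0 : h 0 = 0 by apply: (addrI (h 0)); rewrite -hD !addr0.
have hN u : h (- u) = - h u.
  by apply/eqP; rewrite -addr_eq0 -hD addNr h0.
have hMn u m : h (u *+ m) = h u *+ m.
  by elim: m => [|m IHm]; rewrite ?mulr0n ?h0 // !mulrS hD IHm.
have hMz u (m : int) : h (u *~ m) = m%:~R * h u.
  case: m => m; first by rewrite -!pmulrn hMn mulr_natl.
  by rewrite !NegzE !mulrNz hN -!pmulrn hMn mulNr mulr_natl.
rewrite -[RHS]/(h a) [in RHS](zcoord_sum B a) (big_morph h hD h0).
have hB0 : h (B ord0) = 0 by rewrite /h eps1 mul1r subrr.
rewrite big_ord_recl hMz hB0 mulr0 add0r.
by apply: eq_bigr => i _; rewrite hMz /h mul1r.
Qed.

Lemma lie_twist_LI a b : lie (TL a) (TI b)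
  = (val b - lambda * val a) *: TI (a + b) + (a + b == 0)%:R *: LI_cocycle TC a.
Proof.
have xi0 := twist_xi_neq0 D; have ca := chi_neq0 a.
have zc (w : V) c x y z :
    lie w (c *: (x *: C CL + y *: C CLI0 + z *: C CI)) = 0.
  by rewrite lieZr lie_twist_L_tail scaler0.
rewrite /twist_I -!addrA.
rewrite (lie_pair_mod_center_r _ _ _ (lieLI _ _) (lieII _ _)) //; last first.
  by move=> w; rewrite twist_I_tail_central.
rewrite -gscaleD gscale_eq0 !val_gscale.
have [ab0|ab0] := eqVneq (a + b) 0; last first.
  rewrite !(mulr0, mul0r, scale0r, scaler0, addr0) (twist_chiD D) !scalerA.
  by congr (_ *: _); field; rewrite ?xi0 ?ca.
have -> : b = - a by apply/eqP; rewrite -addr_eq0 addrC ab0.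
rewrite addrN (gscale0 xiG) chi_opp (twist_chi0 D) gvalN eps1.
have [l00|l0N] := boolP (lambda == 0).
  rewrite !LI_cocycle_lambda0 // !lambda0_neq // val_gscale.
  rewrite (eqP l00) !(twist_phi_affine D (eqP l00)) /=.
  rewrite big1 => [|i _]; last by rewrite mulr0 scale0r.
  by apply: V_sep => p pD pN pZ; rewrite scaler0 addr0 !(pD, pN, pZ);
    field; rewrite ?xi0 ?ca.
have [l11|l1N] := boolP (lambda == 1).
  rewrite !LI_cocycle_lambda1 // !lambda1_neq // val_gscale.
  rewrite (eqP l11) /= big1 => [|i _]; last by rewrite mulr0 scale0r.
  by apply: V_sep => p pD pN pZ; rewrite scaler0 addr0 !(pD, pN, pZ);
    field; rewrite ?xi0 ?ca.
have [l22|l2N] := boolP (lambda == -2).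
  have -> : \sum_(i < n) ((zcoord B (gs (B ord0)) (lift ord0 i))%:~R
                 * true%:R) *: C (CLI2 i)
      = \sum_(i < n) (zcoord B (gs (B ord0)) (lift ord0 i))%:~R *: C (CLI2 i).
    by apply: eq_bigr => i _; rewrite mulr1.
  rewrite !LI_cocycle_lambdaN2 // sum_zcoord_CLI2 (eqP l22) /=.
  move: (\sum_(i < n) _) (\sum_(i < n) _) => S S'.
  by apply: V_sep => p pD pN pZ; rewrite !(pD, pN, pZ); field;
    rewrite ?xi0 ?ca.
rewrite !LI_cocycle_generic // big1 => [|i _]; last by rewrite mulr0 scale0r.
by apply: V_sep => p pD pN pZ; rewrite !scaler0 !addr0 !(pD, pN, pZ) /=;
  field; rewrite ?xi0 ?ca.
Qed.

End Lift.
End Formulas.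

(** * Perfectness and uniqueness of lifts *)

Section Uce.
Context (K : numFieldType) (G : zmodClosed K) (n : nat).
Context (B : zbasis G n.+1) (lambda : K).
Local Notation U := (uce B lambda).
Local Notation uL := (uL B lambda).
Local Notation uI := (uI B lambda).
Local Notation uC := (uC B lambda).
Local Notation covering := (@covering K G n B lambda).

Lemma uce_functionals_separate : functionals_separate U.
Proof.
move=> u v uv; apply/malgP => k; apply: (uv (mcoeff k)) => [x y|x|a x].
- exact: mcoeffD.
- exact: mcoeffN.
- exact: mcoeffZ.
Qed.

Lemma uC_present (c : {c : central n | present lambda c}) :
  << inr c >> = uC (val c) :> U.
Proof.
rewrite /uC /uce_C.
by case: insubP => [d _ /val_inj -> //|/negP[]]; apply: valP.
Qed.

Lemma uce_ind (P : U -> Prop) :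
  (forall u v, P u -> P v -> P (u + v)) -> (forall a u, P u -> P (a *: u)) ->
  (forall a, P (uL a)) -> (forall a, P (uI a)) ->
  (forall c, present lambda c -> P (uC c)) -> forall u, P u.
Proof.
move=> PD PZ PL PI PC; have P0 : P 0.
  by rewrite -(scale0r (uL 0)); apply: PZ.
elim/malg_ind => // a k u Pu; apply: (PD (a *: _) u) => //; apply: PZ.
case: k => [[b|b]|c]; [exact: PL|exact: PI|].
by rewrite (uC_present c); apply: PC; apply: valP.
Qed.

Lemma eq_linear_uce (W : lmodType K) (s t : U -> W) :
  linear s -> linear t -> (forall a, s (uL a) = t (uL a)) ->
  (forall a, s (uI a) = t (uI a)) ->
  (forall c, present lambda c -> s (uC c) = t (uC c)) -> s =1 t.
Proof.
move=> sl tl sL sI sC; elim/uce_ind => // [u v su sv|a u su].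
  by rewrite (linD sl) (linD tl) su sv.
by rewrite (linZ sl) (linZ tl) su.
Qed.

(** The linear section [sec] of the covering sends [L_a] to [L_a] and [I_a] to
    [I_a]; every [u] differs from [sec (covering u)] by a central element. *)
Lemma covering_ker_central u v : covering u = 0 -> lie v u = 0.
Proof.
pose sec (w : witt G lambda) : U := lin_ext (fun j => << inl j >> : U) w.
have sec_lin : linear sec by exact: lin_ext_linear.
suff : lie v u = lie v (sec (covering u)).
  by move=> -> ->; rewrite (lin0 sec_lin) lie0r.
move: u; apply: eq_linear_uce => [a x y|a x y|a|a|c _].
- by rewrite lieDr lieZr.
- by rewrite (covering_linear a x y) sec_lin lieDr lieZr.
- by rewrite covering_uL /sec lin_extU.
- by rewrite covering_uI /sec lin_extU.
- by rewrite covering_uC (lin0 sec_lin) lie_uC lie0r.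
Qed.

Lemma lie_uLI_cocycle (a b : grp G) : lie (uL a) (uI b)
  = (val b - lambda * val a) *: uI (a + b)
    + (a + b == 0)%:R *: LI_cocycle B lambda uC a.
Proof. exact: lie_uLI. Qed.

Hypothesis eps1 : val (B ord0) = 1.
Hypothesis lambda_neqN1 : lambda != -1.

(** Perfectness of the extension, as an induction principle. *)
Lemma uce_bracket_ind (P : U -> Prop) :
  (forall u v, P u -> P v -> P (u + v)) -> (forall a u, P u -> P (a *: u)) ->
  (forall u v, P (lie u v)) -> forall u, P u.
Proof.
move=> PD PZ Pbr.
have P0 : P 0 by rewrite -(lie0l (uL 0)).
have PB u v : P u -> P v -> P (u - v).
  by move=> Pu Pv; rewrite -scaleN1r; apply: (PD) => //; apply: PZ.
have Pinv a u : a != 0 -> P (a *: u) -> P u.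
  by move=> a0 Pau; rewrite -[u]scale1r -(mulVf a0) -scalerA; apply: PZ.
pose one : grp G := B ord0.
have lambda1 : 1 + lambda != 0 by rewrite addrC addr_eq0.
have PL a : P (uL a).
  have [->|a0] := eqVneq a 0; last first.
    apply: (Pinv (val a)); first by rewrite (val_eqE a 0).
    have := Pbr (uL 0) (uL a).
    rewrite lie_uLL add0r (negPf a0) mulr0 scale0r addr0.
    by rewrite ?gvalE subr0.
  have := Pbr (uL (- one)) (uL one).
  rewrite lie_uLL addNr eqxx ?gvalE eps1 => H.
  apply: (Pinv 2); first by rewrite pnatr_eq0.
  move: H; congr P; apply: uce_functionals_separate => p pD pN pZ.
  by rewrite !(pD, pN, pZ) ?mulr1; field.
(* The bracket of [L_{-1}] and [I_1] is used rather than that of [L_1] and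
   [I_{-1}] because the cocycle vanishes at [- 1] for every [lambda]. *)
have PI a : P (uI a).
  have [->|a0] := eqVneq a 0; last first.
    apply: (Pinv (val a)); first by rewrite (val_eqE a 0).
    have := Pbr (uL 0) (uI a).
    rewrite lie_uLI_cocycle add0r (negPf a0) scale0r addr0.
    by rewrite ?gvalE mulr0 subr0.
  have := Pbr (uL (- one)) (uI one).
  rewrite lie_uLI_cocycle addNr eqxx ?gvalE eps1 => H.
  apply: (Pinv _ _ lambda1).
  move: H; congr P; apply: uce_functionals_separate => p pD pN pZ.
  rewrite /LI_cocycle ?gvalE eps1.
  rewrite big1 => [|i _].
    by rewrite addr0 !(pD, pN, pZ) /=; field.
  rewrite zcoordN zcoord_basis eq_sym (negPf (neq_lift _ _)).
  by rewrite oppr0 mul0r scale0r.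
have PLI a : P (LI_cocycle B lambda uC a).
  rewrite (_ : LI_cocycle B lambda uC a = lie (uL a) (uI (- a))
     - (val (- a) - lambda * val a) *: uI (a - a)).
    exact: PB (Pbr _ _) (PZ _ _ (PI _)).
  by rewrite lie_uLI_cocycle addrN eqxx scale1r [X in X - _]addrC addrK.
elim/uce_ind => // -[] /=.
- move=> _.
  (* The bracket of [L_{-2}] and [L_2] is [4 L_0 - C_L / 2]; at [1] instead of
     [2] the cocycle [a ^+ 3 - a] vanishes. *)
  have := PB _ _ (Pbr (uL (- (one + one))) (uL (one + one))) (PZ 4 _ (PL 0)).
  rewrite lie_uLL addNr eqxx ?gvalE eps1 => H.
  apply: (Pinv (- 2^-1)); first by rewrite oppr_eq0 invr_eq0 pnatr_eq0.
  move: H; congr P; apply: uce_functionals_separate => p pD pN pZ.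
  by rewrite !(pD, pN, pZ) ?mulr1; field.
- move=> l0; have := Pbr (uI one) (uI (- one)).
  by rewrite lie_uII addrN eqxx l0 eps1 !mulr1 scale1r.
- move=> l0; have := PLI one; rewrite LI_cocycle_lambda0 // eps1; apply: Pinv.
  by rewrite expr1n -(natrD _ 1 1) pnatr_eq0.
- move=> l1; have := PLI (one + one); rewrite LI_cocycle_lambda1 // gvalE eps1.
  apply: Pinv; rewrite (_ : _ * _ = 2^-1); last by field.
  by rewrite invr_eq0 pnatr_eq0.
- move=> i l2; have := PLI (B (lift ord0 i)); rewrite LI_cocycle_lambdaN2 //.
  rewrite (bigD1 i) //= zcoord_basis eqxx scale1r.
  rewrite big1 ?addr0 // => j /negPf ji.
  by rewrite zcoord_basis (inj_eq lift_inj) ji scale0r.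
Qed.

(** A bracket is insensitive to central changes of its arguments, so [s] and [t]
    agree on brackets, and these span by perfectness. *)
Lemma lie_hom_eq_mod_center (W : lieAlgType K) (s t : U -> W) :
  lie_hom s -> lie_hom t -> (forall u w, lie w (s u - t u) = 0) -> s =1 t.
Proof.
move=> [sl sm] [tl tm] st.
have swap w u : lie w (s u) = lie w (t u).
  by rewrite -[s u](subrK (t u)) lieDr st add0r.
elim/uce_bracket_ind => [u v su sv|a u su|u v].
- by rewrite (linD sl) (linD tl) su sv.
- by rewrite (linZ sl) (linZ tl) su.
- by rewrite sm tm swap lieC swap -lieC.
Qed.

Lemma lie_hom_lift_uniq (s t : U -> U) :
  lie_hom s -> lie_hom t -> (forall u, covering (s u) = covering (t u)) ->
  s =1 t.
Proof.
move=> sh th st; apply: lie_hom_eq_mod_center => // u w.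
apply: covering_ker_central; rewrite -scaleN1r.
rewrite (linD (@covering_linear _ _ _ _ _)) (linZ (@covering_linear _ _ _ _ _)).
by rewrite st scaleN1r addrN.
Qed.

(** * The lift is a homomorphism *)

Section TwistLift.
Variables (xi l l0 l1 : K) (chi phi : grp G -> K).
Local Notation TL := (twist_L lambda xi l0 l1 chi phi uL uI uC).
Local Notation TI := (twist_I B lambda xi l l0 l1 chi uI uC).
Local Notation TC := (twist_C B lambda xi l l1 uC).

Definition twist_map (w : witt G lambda) : witt G lambda :=
  lin_ext (fun k => match k with
    | inl a => (xi^-1 * chi a) *: wL lambda (gscale xi a)
               + (chi a * phi a) *: wI lambda (gscale xi a)
    | inr a => (l * chi a) *: wI lambda (gscale xi a)
    end) w.

Definition twist_lift (u : U) : U :=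
  lin_ext (fun k => match k with
                    | inl (inl a) => TL a
                    | inl (inr a) => TI a
                    | inr c => TC (val c)
                    end) u.

Lemma twist_map_linear : linear twist_map.
Proof. exact: lin_ext_linear. Qed.

Lemma twist_map_wL a : twist_map (wL lambda a) =
  (xi^-1 * chi a) *: wL lambda (gscale xi a)
  + (chi a * phi a) *: wI lambda (gscale xi a).
Proof. exact: lin_extU. Qed.

Lemma twist_map_wI a :
  twist_map (wI lambda a) = (l * chi a) *: wI lambda (gscale xi a).
Proof. exact: lin_extU. Qed.

Lemma twist_lift_linear : linear twist_lift.
Proof. exact: lin_ext_linear. Qed.

Lemma twist_lift_uL a : twist_lift (uL a) = TL a.
Proof. exact: lin_extU. Qed.

Lemma twist_lift_uI a : twist_lift (uI a) = TI a.
Proof. exact: lin_extU. Qed.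

Lemma twist_lift_uC c : present lambda c -> twist_lift (uC c) = TC c.
Proof.
move=> pc; rewrite -[c]/(val (exist _ c pc : {c | present lambda c})).
by rewrite -uC_present /twist_lift lin_extU.
Qed.

Lemma covering_twist_L a : covering (TL a) =
  (xi^-1 * chi a) *: wL lambda (gscale xi a)
  + (chi a * phi a) *: wI lambda (gscale xi a).
Proof.
rewrite (twist_L_mod_C _ _ _ _ _ _ _ _ (@covering_linear _ _ _ B lambda)
  (@covering_uC _ _ _ B lambda)).
exact: (congr2 (fun u v => (xi^-1 * chi a) *: u + (chi a * phi a) *: v)
  (covering_uL _ _ _) (covering_uI _ _ _)).
Qed.

Lemma covering_twist_I a :
  covering (TI a) = (l * chi a) *: wI lambda (gscale xi a).
Proof.
rewrite (twist_I_mod_C _ _ _ _ _ _ _ _ (@covering_linear _ _ _ B lambda)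
  (@covering_uC _ _ _ B lambda)).
exact: (congr1 (fun u => (l * chi a) *: u) (covering_uI _ _ _)).
Qed.

Lemma covering_twist_C c : covering (TC c) = 0.
Proof.
apply: (twist_C_mod_C _ _ _ _ _ (@covering_linear _ _ _ _ _)) => c'.
exact: covering_uC.
Qed.

Lemma covering_twist_lift u : covering (twist_lift u) = twist_map (covering u).
Proof.
have cl := @covering_linear K G n B lambda.
have ml := twist_map_linear; have tl := twist_lift_linear.
move: u; apply: eq_linear_uce => [a u v|a u v|a|a|c pc].
- by rewrite tl cl.
- by rewrite cl ml.
- by rewrite twist_lift_uL covering_twist_L covering_uL twist_map_wL.
- by rewrite twist_lift_uI covering_twist_I covering_uI twist_map_wI.
- by rewrite twist_lift_uC // covering_twist_C covering_uC (lin0 ml).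
Qed.

Hypothesis D : twist_data lambda xi l0 l1 chi phi.

Lemma twist_lift_LI_cocycle a :
  twist_lift (LI_cocycle B lambda uC a) = LI_cocycle B lambda TC a.
Proof.
have tl := twist_lift_linear.
have [l0E|l0N] := boolP (lambda == 0).
  by rewrite !LI_cocycle_lambda0 // (linZ tl) twist_lift_uC.
have [l1E|l1N] := boolP (lambda == 1).
  by rewrite !LI_cocycle_lambda1 // (linZ tl) twist_lift_uC.
have [l2E|l2N] := boolP (lambda == -2); last first.
  by rewrite !LI_cocycle_generic // (lin0 tl).
rewrite !LI_cocycle_lambdaN2 // (lin_sum tl); apply: eq_bigr => i _.
by rewrite (linZ tl) twist_lift_uC.
Qed.

(** By bilinearity it suffices to treat pairs of basis vectors. *)
Lemma twist_lift_hom : lie_hom twist_lift.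
Proof.
have tl := twist_lift_linear; split=> //.
have sep := uce_functionals_separate.
have central u c : present lambda c -> lie u (twist_lift (uC c)) = 0.
  move=> pc; apply: covering_ker_central.
  by rewrite covering_twist_lift covering_uC (lin0 twist_map_linear).
have tN u : twist_lift (- u) = - twist_lift u.
  by rewrite -scaleN1r (linZ tl) scaleN1r.
have LL a b : twist_lift (lie (uL a) (uL b)) = lie (TL a) (TL b).
  rewrite (lie_twist_LL l D eps1 lambda_neqN1 sep (lie_uLL B lambda)
    lie_uLI_cocycle (lie_uII B lambda) (@lie_uC _ _ _ B lambda)).
  by rewrite lie_uLL (linD tl) 2!(linZ tl) twist_lift_uL twist_lift_uC.
have LI a b : twist_lift (lie (uL a) (uI b)) = lie (TL a) (TI b).
  rewrite (lie_twist_LI l D eps1 sep lie_uLI_cocycle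
    (lie_uII B lambda) (@lie_uC _ _ _ B lambda)).
  rewrite lie_uLI_cocycle (linD tl) 2!(linZ tl).
  by rewrite twist_lift_uI twist_lift_LI_cocycle.
have II a b : twist_lift (lie (uI a) (uI b)) = lie (TI a) (TI b).
  rewrite (lie_twist_II B l D (lie_uII B lambda) (@lie_uC _ _ _ B lambda)).
  rewrite lie_uII (linZ tl).
  have [l0E|l0N] := boolP (lambda == 0); first by rewrite twist_lift_uC.
  by rewrite mulr0 !scale0r.
move=> u v; move: u.
apply: (eq_linear_uce (s := fun u => twist_lift (lie u v))
  (t := fun u => lie (twist_lift u) (twist_lift v)))
  => [x u u'|x u u'|a|a|c pc].
- by rewrite lieDl lieZl tl.
- by rewrite tl lieDl lieZl.
- rewrite twist_lift_uL; move: v.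
  apply: (eq_linear_uce (s := fun v => twist_lift (lie (uL a) v))
    (t := fun v => lie (TL a) (twist_lift v))) => [x v v'|x v v'|b|b|c pc].
  + by rewrite lieDr lieZr tl.
  + by rewrite tl lieDr lieZr.
  + by rewrite twist_lift_uL; exact: LL.
  + by rewrite twist_lift_uI; exact: LI.
  + by apply: etrans (esym (central _ _ pc)); rewrite lie_uC; apply: lin0 tl.
- rewrite twist_lift_uI; move: v.
  apply: (eq_linear_uce (s := fun v => twist_lift (lie (uI a) v))
    (t := fun v => lie (TI a) (twist_lift v))) => [x v v'|x v v'|b|b|c pc].
  + by rewrite lieDr lieZr tl.
  + by rewrite tl lieDr lieZr.
  + by rewrite lieC tN LI twist_lift_uL -lieC.
  + by rewrite twist_lift_uI; exact: II.
  + by apply: etrans (esym (central _ _ pc)); rewrite lie_uC; apply: lin0 tl.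
- rewrite [RHS]lieC; apply: etrans (esym (congr1 -%R (central _ _ pc))).
  by rewrite lieC lie_uC oppr0; apply: lin0 tl.
Qed.

End TwistLift.
End Uce.

(** * Bijectivity by lifting the inverse *)

Section TwistInverse.
Context (K : numFieldType) (G : zmodClosed K) (n : nat).
Context (B : zbasis G n.+1) (lambda : K).

Lemma twist_map_comp_id (xi l xi' l' : K) (chi phi chi' phi' : grp G -> K) :
  xi' * xi = 1 -> l' * l = 1 ->
  (forall a : grp G, gscale xi' (gscale xi a) = a) ->
  (forall a, chi' (gscale xi a) * chi a = 1) ->
  (forall a, phi' (gscale xi a) = - (l' * xi * phi a)) ->
  cancel (twist_map (lambda := lambda) xi l chi phi)
         (twist_map xi' l' chi' phi').
Proof.
move=> xiK lK gsK chiK phiK.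
have xi0 : xi != 0.
  by apply: contra_eq_neq xiK => ->; rewrite mulr0 eq_sym oner_eq0.
have xi'E : xi' = xi^-1 by rewrite -[LHS](mulfK xi0) xiK mul1r.
have ml := @twist_map_linear K G lambda xi l chi phi.
have ml' := @twist_map_linear K G lambda xi' l' chi' phi'.
apply: eq_linear_malg => [a u v|a u v|[a|a]].
- by rewrite ml ml'.
- by [].
- rewrite (twist_map_wL lambda xi l chi phi a) (lin_comb2 ml').
  apply: etrans (congr2 (fun u v => (xi^-1 * chi a) *: u + (chi a * phi a) *: v)
    (twist_map_wL _ _ _ _ _ _) (twist_map_wI _ _ _ _ _ _)) _.
  rewrite gsK; apply: unitriangular_cancel.
    rewrite xi'E invrK -[RHS](chiK a); field; exact: xi0.
  rewrite phiK; field; exact: xi0.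
- rewrite (twist_map_wI lambda xi l chi phi a) (linZ ml').
  apply: etrans (congr1 (fun u => (l * chi a) *: u)
    (twist_map_wI _ _ _ _ _ _)) _.
  rewrite gsK scalerA (_ : _ * _ = (l' * l) * (chi' (gscale xi a) * chi a)).
    by rewrite lK chiK mulr1 scale1r.
  by ring.
Qed.

Hypothesis eps1 : val (B ord0) = 1.
Hypothesis lambda_neqN1 : lambda != -1.

(** The composite of the two lifts is a homomorphism over the identity of
    g(G, lambda), as is the identity. *)
Lemma twist_lift_cancel (xi l l0 l1 xi' l' l0' l1' : K)
    (chi phi chi' phi' : grp G -> K) :
  twist_data lambda xi l0 l1 chi phi ->
  twist_data lambda xi' l0' l1' chi' phi' ->
  xi' * xi = 1 -> l' * l = 1 ->
  (forall a, chi' (gscale xi a) * chi a = 1) ->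
  (forall a, phi' (gscale xi a) = - (l' * xi * phi a)) ->
  cancel (twist_lift (B := B) (lambda := lambda) xi l l0 l1 chi phi)
         (twist_lift xi' l' l0' l1' chi' phi').
Proof.
move=> D D' xiK lK chiK phiK u.
have [tl tm] := twist_lift_hom eps1 lambda_neqN1 l D.
have [tl' tm'] := twist_lift_hom eps1 lambda_neqN1 l' D'.
apply: (lie_hom_lift_uniq eps1 lambda_neqN1
  (s := fun u => twist_lift xi' l' l0' l1' chi' phi'
                   (twist_lift xi l l0 l1 chi phi u)) (t := id)) => [||v].
- by split=> [a v w|v w]; [rewrite tl tl'|rewrite tm tm'].
- by [].
- rewrite !covering_twist_lift; apply: twist_map_comp_id => // a.
  apply: val_inj.
  rewrite (val_gscale (twist_xiG D')) (val_gscale (twist_xiG D)).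
  by rewrite mulrA xiK mul1r.
Qed.

Variables (xi l l0 l1 : K) (chi phi : grp G -> K).
Hypothesis D : twist_data lambda xi l0 l1 chi phi.
Hypothesis xiVG : forall x, x \in G -> xi^-1 * x \in G.
Hypothesis l_neq0 : l != 0.

Let chi' (a : grp G) := (chi (gscale xi^-1 a))^-1.
Let phi' (a : grp G) := - (l^-1 * xi * phi (gscale xi^-1 a)).

(** Solving [theta (theta' L_a) = L_a] and [theta (theta' I_a) = I_a] gives
    [chi'] and [phi'], with [l' = l^-1]; for [lambda = 0] the new [phi'] is
    affine with the displayed coefficients. *)
Lemma twist_data_inv : twist_data lambda xi^-1
  (- (l^-1 * xi * l0)) (- (l^-1 * l1)) chi' phi'.
Proof.
have xi0 := twist_xi_neq0 D.
split=> //; first by rewrite invr_eq0.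
- by rewrite /chi' (gscale0 xiVG) (twist_chi0 D) invr1.
- by move=> a b; rewrite /chi' (gscaleD xiVG) (twist_chiD D) invfM.
- move=> a b; rewrite /phi' (gscaleD xiVG).
  have := twist_phi_cocycle D (gscale xi^-1 a) (gscale xi^-1 b).
  rewrite !(val_gscale xiVG); move: (phi _) (phi _) (phi _) => p q r E.
  transitivity (- (l^-1 * xi ^+ 2 * ((xi^-1 * val b - xi^-1 * val a) * p))).
    by rewrite -E; field; rewrite ?xi0 ?l_neq0.
  by field; rewrite ?xi0 ?l_neq0.
- move=> lambda0 a; rewrite /phi' (twist_phi_affine D lambda0).
  by rewrite (val_gscale xiVG); field; rewrite ?xi0 ?l_neq0.
Qed.

Lemma twist_lift_bij :
  bijective (twist_lift (B := B) (lambda := lambda) xi l l0 l1 chi phi).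
Proof.
have xi0 := twist_xi_neq0 D; have xiG := twist_xiG D.
exists (twist_lift xi^-1 l^-1 (- (l^-1 * xi * l0)) (- (l^-1 * l1)) chi' phi').
  apply: (twist_lift_cancel D twist_data_inv); rewrite ?mulVf // => a.
    rewrite /chi'; have -> : gscale xi^-1 (gscale xi a) = a.
      by apply: val_inj; rewrite (val_gscale xiVG) (val_gscale xiG) mulKf.
    by rewrite mulVf // (chi_neq0 D).
  rewrite /phi'; have -> // : gscale xi^-1 (gscale xi a) = a.
  by apply: val_inj; rewrite (val_gscale xiVG) (val_gscale xiG) mulKf.
apply: (twist_lift_cancel twist_data_inv D); rewrite ?mulfV // => a.
  by rewrite /chi' mulfV // (chi_neq0 D).
by rewrite /phi'; field; rewrite ?xi0 ?l_neq0.
Qed.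

End TwistInverse.

(** * The extension of [theta] *)

Theorem theorem4p5 (R : realType) (G : zmodClosed R[i]) (n : nat)
    (B : zbasis G n.+1) (lambda xi l l0 l1 l3 : R[i])
    (chi : grp G -> R[i]) (f : {additive grp G -> R[i]})
    (theta : witt G lambda -> witt G lambda)
    (eps1 : val (B ord0) = 1)
    (inv_notin : forall k : nat, (1 < k)%N -> k%:R^-1 \notin G)
    (lambda_neqN1 : lambda != -1)
    (xi_neq0 : xi != 0)
    (xiG : forall x : R[i], x \in G <-> exists2 y, y \in G & x = xi * y)
    (chi_neq0 : forall a, chi a != 0)
    (chiD : forall a b, chi (a + b) = chi a * chi b)
    (l_neq0 : l != 0)
    (theta_aut : lie_aut theta)
    (thetaL : forall a, theta (wL lambda a)
       = (xi^-1 * chi a) *: wL lambda (gscale xi a)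
         + (chi a * (l0 * (lambda == 0)%:R + l1 * val a
                     + l3 * val a ^+ 3 * (lambda == -2)%:R
                     + f a * (lambda == 1)%:R)) *: wI lambda (gscale xi a))
    (thetaI : forall a, theta (wI lambda a)
       = (l * chi a) *: wI lambda (gscale xi a)) :
  (exists! t : uce B lambda -> uce B lambda, lifts_aut theta t)
  /\ forall t : uce B lambda -> uce B lambda, lifts_aut theta t ->
    (forall a, t (uL B lambda a)
       = (xi^-1 * chi a) *: uL B lambda (gscale xi a)
         + (chi a * (l0 * (lambda == 0)%:R + l1 * val a
                     + l3 * val a ^+ 3 * (lambda == -2)%:R
                     + f a * (lambda == 1)%:R)) *: uI B lambda (gscale xi a)
         + (a == 0)%:R *:
           (((xi^-1 - xi) / 24) *: uC B lambda CL
            + ((l1 * xi - l0) * (lambda == 0)%:R) *: uC B lambda CLI0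
            + (2^-1 * xi * (l1 ^+ 2 - l0 ^+ 2) * (lambda == 0)%:R)
              *: uC B lambda CI))
    /\ (forall a, t (uI B lambda a)
       = (l * chi a) *: uI B lambda (gscale xi a)
         + (l * xi * (a == 0)%:R) *:
           (((xi^-1 - xi) / 24 * (lambda == 1)%:R) *: uC B lambda CLI1
            + (lambda == 0)%:R *: ((1 - xi^-1) *: uC B lambda CLI0
                                   + (l1 - l0) *: uC B lambda CI))
         + (l * (xi * val (B ord0))^-1 * (a == 0)%:R) *:
           \sum_(i < n) ((zcoord B (gscale xi (B ord0)) (lift ord0 i))%:~R
                         * (lambda == -2)%:R) *: uC B lambda (CLI2 i))
    /\ t (uC B lambda CL)
       = xi *: uC B lambda CL
         - (12 * l1 * xi * (lambda == 0)%:R) *: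
           (2 *: uC B lambda CLI0 + l1 *: uC B lambda CI)
    /\ (lambda = 0 ->
        t (uC B lambda CLI0)
          = (l * xi) *: (uC B lambda CLI0 + l1 *: uC B lambda CI)
        /\ t (uC B lambda CI) = (l ^+ 2 * xi) *: uC B lambda CI)
    /\ (lambda = 1 ->
        t (uC B lambda CLI1) = (l * xi ^+ 2) *: uC B lambda CLI1)
    /\ (lambda = -2 -> forall i : 'I_n,
        t (uC B lambda (CLI2 i))
          = (l * (xi * val (B ord0))^-1) *:
            \sum_(j < n)
              (val (B ord0)
                 * (zcoord B (gscale xi (B (lift ord0 i))) (lift ord0 j))%:~R
               - val (B (lift ord0 i))
                 * (zcoord B (gscale xi (B ord0)) (lift ord0 j))%:~R)
              *: uC B lambda (CLI2 j)).
Proof.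
pose phi (a : grp G) : R[i] := l0 * (lambda == 0)%:R + l1 * val a
  + l3 * val a ^+ 3 * (lambda == -2)%:R + f a * (lambda == 1)%:R.
have D : twist_data lambda xi l0 l1 chi phi.
  split=> //.
  - by move=> x xG; apply/xiG; exists x.
  - by apply: (mulfI (chi_neq0 0)); rewrite -chiD addr0 mulr1.
  (* Each summand of [phi] satisfies the identity for the values of [lambda] at
     which it occurs. *)
  - move=> a b; rewrite /phi (raddfD f) gvalD.
    have [l0E|l0N] := boolP (lambda == 0).
      by rewrite !lambda0_neq // (eqP l0E) /=; ring.
    have [l1E|l1N] := boolP (lambda == 1).
      by rewrite !lambda1_neq // (eqP l1E) /=; ring.
    have [l2E|l2N] := boolP (lambda == -2); last by rewrite /=; ring.
    by rewrite (eqP l2E) /=; ring.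
  - move=> /eqP l0E a; rewrite /phi l0E !lambda0_neq //.
    by rewrite !mulr0 !addr0 mulr1.
have xiVG x : x \in G -> xi^-1 * x \in G.
  by case/xiG=> y yG ->; rewrite mulKf.
set T := twist_lift (B := B) (lambda := lambda) xi l l0 l1 chi phi.
have Thom : lie_hom T by apply: twist_lift_hom.
have [[theta_lin _] _] := theta_aut.
have thetaE : twist_map xi l chi phi =1 theta.
  apply: eq_linear_malg; [exact: twist_map_linear|exact: theta_lin|case=> a].
    by apply: etrans (twist_map_wL _ _ _ _ _ _) (esym (thetaL a)).
  by apply: etrans (twist_map_wI _ _ _ _ _ _) (esym (thetaI a)).
have Tlift : lifts_aut theta T.
  split=> [|u]; last by rewrite covering_twist_lift thetaE.
  by split=> //; apply: twist_lift_bij.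
have uniq t : lifts_aut theta t -> t =1 T.
  case=> [[th _] tc]; apply: (lie_hom_lift_uniq eps1 lambda_neqN1 th Thom) => u.
  by rewrite tc; case: Tlift => _ ->.
split.
  exists T; split=> // t /uniq tT; apply/esym; exact: boolp.funext.
move=> t /uniq tT; split=> [a|].
  by apply: etrans (tT _) (twist_lift_uL _ _ _ _ _ _ _ _ _).
split=> [a|].
  by apply: etrans (tT _) (twist_lift_uI _ _ _ _ _ _ _ _ _).
have tC c : present lambda c ->
    t (uC B lambda c) = twist_C B lambda xi l l1 (uC B lambda) c.
  by move=> pc; apply: etrans (tT _) (twist_lift_uC _ _ _ _ _ _ _ _).
split; first exact: tC.
split=> [/eqP l0E|]; first by split; apply: tC.
split=> [/eqP l1E|/eqP l2E i]; exact: tC.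
Qed.
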